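(* Every Borel graph of polynomial growth is hyperfinite.
   Context: Graphs are undirected and simple. A Borel graph is a graph $G$ whose vertex set is a standard Borel space and whose adjacency relation is a Borel subset of $V(G)^2$. Let $B_G(u,r)$ be the closed ball of radius $r$ around $u$ in the graph metric (distance $\infty$ between different components), $\gamma_G(r)=\sup_{u\in V(G)}|B_G(u,r)|$, and $\mathrm{ar}(G)=\limsup_{r\to\infty}\frac{\log\gamma_G(r)}{\log(r+1)}$; $G$ is of polynomial growth if $\mathrm{ar}(G)<\infty$. A Borel equivalence relation $E$ on a standard Borel space $X$ (i.e., one that is a Borel subset of $X\times X$) is finite if every $E$-class is finite, and hyperfinite if there is an increasing sequence $E_0\subseteq E_1\subseteq\cdots$ of finite Borel equivalence relations on $X$ with $\bigcup_n E_n=E$. A Borel graph $G$ is hyperfinite if its connectedness relation $\sim_G$ (the equivalence relation on $V(G)$ whose classes are the connected components of $G$) is a hyperfinite equivalence relation. *)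

(* Defs.v *)
From mathcomp Require Import all_boot all_order all_algebra.
From mathcomp Require Import all_classical all_reals all_analysis.
From Stdlib Require Import RelationClasses.

Set Implicit Arguments.
Unset Strict Implicit.
Unset Printing Implicit Defensive.

Import Order.TTheory GRing.Theory Num.Theory.
Import numFieldNormedType.Exports.

Local Open Scope classical_set_scope.
Local Open Scope ring_scope.

(* A Borel structure on V is a family B of subsets of V rather than a
   measurableType: the latter is pointed, and the empty standard Borel space
   has to be allowed.  For the same reason completeness of a metric space is
   spelled out instead of using completeType, which is also pointed. *)

Definition complete_metric (R : realType) (T : metricType R) : Prop :=
  forall F : set_system T, ProperFilter F -> cauchy F -> exists l : T, F --> l.

Definition separable (T : topologicalType) : Prop :=
  exists2 D : set T, countable D & dense D.

(* (V, B) is isomorphic, as a measurable space, to a Polish space with its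
   Borel sigma-algebra; f is the isomorphism. *)
Definition standard_borel (R : realType) (V : Type) (B : set_system V) : Prop :=
  exists (T : metricType R) (f : V -> T),
    [/\ complete_metric T, separable T, bijective f &
        B = [set f @^-1` A | A in <<s @open T >>]].

(* E is measurable for the product sigma-algebra on V * V. *)
Definition borel_relation (V : Type) (B : set_system V)
    (E : V -> V -> Prop) : Prop :=
  <<s [set X `*` Y | X in B & Y in B] >> [set p | E p.1 p.2].

Definition borel_graph (R : realType) (V : Type) (B : set_system V)
    (G : V -> V -> Prop) : Prop :=
  [/\ standard_borel R B, Symmetric G, (forall u, ~ G u u) &
      borel_relation B G].

Section GraphMetric.
Variables (V : choiceType) (G : V -> V -> Prop).

Definition walk (u v : V) (n : nat) : Prop :=
  exists p : seq V,
    [/\ path (fun x y => `[< G x y >]) u p, last u p = v & size p = n].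

Definition connected_in (u v : V) : Prop := exists n, walk u v n.

Variable R : realType.
Local Open Scope ereal_scope.

(* The infimum of the empty set is +oo, the distance between two vertices of
   different components. *)
Definition gdist (u v : V) : \bar R := ereal_inf [set n%:R%:E | n in walk u v].

Definition gball (u : V) (r : nat) : set V := [set v | gdist u v <= r%:R%:E].

(* counting is +oo on infinite sets. *)
Definition growth (r : nat) : \bar R :=
  ereal_sup [set counting (gball u r) | u in [set: V]].

Definition growth_rate : \bar R :=
  limn_esup (fun r => lne (growth r) / (ln r.+1%:R)%:E).

Definition polynomial_growth : Prop := growth_rate < +oo.

End GraphMetric.

Definition borel_equivalence (V : Type) (B : set_system V)
    (E : V -> V -> Prop) : Prop :=
  Equivalence E /\ borel_relation B E.

Definition finite_borel_equivalence (V : Type) (B : set_system V)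
    (E : V -> V -> Prop) : Prop :=
  borel_equivalence B E /\ forall x, finite_set [set y | E x y].

Definition hyperfinite (V : Type) (B : set_system V)
    (E : V -> V -> Prop) : Prop :=
  borel_equivalence B E /\
  exists En : nat -> V -> V -> Prop,
    [/\ forall n, finite_borel_equivalence B (En n),
        forall n x y, En n x y -> En n.+1 x y &
        forall x y, E x y <-> exists n, En n x y].

Definition hyperfinite_graph (V : choiceType) (B : set_system V)
    (G : V -> V -> Prop) : Prop :=
  hyperfinite B (connected_in G).

(* Main.v *)
Require Import Defs.
From mathcomp Require Import all_boot all_order all_algebra.
From mathcomp Require Import all_classical all_reals all_analysis zify.
From Stdlib Require Import RelationClasses.

(* Polynomial growth bounds every degree, so by the finite case of the
   Luzin-Novikov theorem (proved from the separation of disjoint analytic sets)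
   the neighbours of a vertex are enumerated by countably many Borel maps, and
   quantifiers over a connected component become countable.

   Every vertex x is doubling at infinitely many scales s = 16^k, that is
   |B(x, 16 s)| <= D |B(x, s)|, for otherwise |B(x, 16^k)| would outgrow any
   polynomial bound of the given degree.  Starting from equality, at scale s
   merge the classes near a maximal Borel 2s-discrete set of doubling points
   according to the nearby point of least colour, for a Borel colouring of V.
   This yields an increasing sequence of finite Borel equivalence relations E_n
   with bounded classes.  Given pairwise inequivalent points x_1, ..., x_N of one
   component, look at a large doubling scale of x_1: all x_i are absorbed by
   distinct centres close to x_1, so N <= D by packing.  Hence every component is
   a union of at most D classes of the union of the E_n, and an extension of
   finite index of an increasing union of finite relations is again one. *)

Set Implicit Arguments.
Unset Strict Implicit.
Unset Printing Implicit Defensive.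

Import Order.TTheory GRing.Theory Num.Theory.

Local Open Scope classical_set_scope.
Local Open Scope ring_scope.

(** * Sigma-algebras and measurable maps *)

Section SigmaAlgebraPredicates.
Variables (X : Type) (M : set_system X).
Hypothesis saM : sigma_algebra setT M.

Lemma sigma_not (P : set X) : M P -> M (fun x => ~ P x).
Proof. by case: saM => _ C _ /C; rewrite setTD. Qed.

Lemma sigma_const (P : Prop) : M (fun _ => P).
Proof.
case: saM => M0 _ _; have [p|np] := pselect P.
  rewrite (_ : (fun _ => P) = (fun x => ~ (set0 : set X) x)); first exact: sigma_not.
  by apply/funext => x; apply/propext; split => // _ [].
rewrite (_ : (fun _ => P) = set0) //.
by apply/funext => x; apply/propext; split.
Qed.

Lemma sigma_ex (I : countType) (P : I -> set X) :
  (forall i, M (P i)) -> M (fun x => exists i, P i x).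
Proof.
case: saM => M0 _ U MP.
pose A n := if unpickle n is Some i then P i else set0.
rewrite (_ : (fun x => _) = \bigcup_n A n).
  by apply: U => n; rewrite /A; case: (unpickle n).
apply/funext => x; apply/propext; split=> [[i Pi]|[n _]].
  by exists (pickle i) => //; rewrite /A pickleK.
by rewrite /A; case: (unpickle n) => [i|//]; exists i.
Qed.

Lemma sigma_all (I : countType) (P : I -> set X) :
  (forall i, M (P i)) -> M (fun x => forall i, P i x).
Proof.
move=> MP; rewrite (_ : (fun x => _) = fun x => ~ exists i, ~ P i x).
  by apply/sigma_not/sigma_ex => i; exact/sigma_not.
apply/funext => x; apply/propext; split=> [h [i]|h i]; first exact.
by apply: contrapT => nP; apply: h; exists i.
Qed.

Lemma sigma_or (P Q : set X) : M P -> M Q -> M (fun x => P x \/ Q x).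
Proof.
move=> MP MQ; rewrite (_ : (fun x => _) = fun x => exists b : bool, (if b then P else Q) x).
  by apply: sigma_ex => -[].
apply/funext => x; apply/propext; split=> [[]|[[]]].
- by exists true.
- by exists false.
- by left.
- by right.
Qed.

Lemma sigma_and (P Q : set X) : M P -> M Q -> M (fun x => P x /\ Q x).
Proof.
move=> MP MQ; rewrite (_ : (fun x => _) = fun x => forall b : bool, (if b then P else Q) x).
  by apply: sigma_all => -[].
apply/funext => x; apply/propext; split=> [[? ?] []//|h].
by split; [exact: (h true)|exact: (h false)].
Qed.

Lemma sigma_imp (P Q : set X) : M P -> M Q -> M (fun x => P x -> Q x).
Proof.
move=> MP MQ; rewrite (_ : (fun x => _) = fun x => ~ P x \/ Q x).
  by apply: sigma_or => //; exact: sigma_not.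
by apply/funext => x; apply/propext; rewrite implyE.
Qed.

Lemma sigma_guard (P : Prop) (Q : set X) : (P -> M Q) -> M (fun x => P /\ Q x).
Proof.
move=> h; have [p|np] := pselect P; first by apply: sigma_and (h p); exact: sigma_const.
rewrite (_ : (fun x => _) = fun _ => False); first exact: sigma_const.
by apply/funext => x; apply/propext; split => // -[].
Qed.

End SigmaAlgebraPredicates.

Definition measurable_map (X Y : Type) (M : set_system X) (N : set_system Y)
  (g : X -> Y) := forall A, N A -> M (g @^-1` A).

Lemma measurable_map_id (X : Type) (M : set_system X) : measurable_map M M id.
Proof. by move=> A; rewrite preimage_id. Qed.

Lemma measurable_map_comp (X Y Z : Type) (L : set_system X) (M : set_system Y) (N : set_system Z)
  (g : X -> Y) (h : Y -> Z) : measurable_map L M g -> measurable_map M N h ->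
  measurable_map L N (fun x => h (g x)).
Proof. by move=> mg mh A /mh/mg. Qed.

Lemma sigma_generated (X : Type) (G : set_system X) : sigma_algebra setT <<s G >>.
Proof. exact: smallest_sigma_algebra. Qed.

Lemma measurable_map_generated (X Y : Type) (M : set_system X) (G : set_system Y) (g : X -> Y) :
  sigma_algebra setT M -> (forall A, G A -> M (g @^-1` A)) ->
  measurable_map M <<s G >> g.
Proof.
move=> saM GM A /(_ (fun A => M (g @^-1` A))); apply; split => //; split.
- by rewrite preimage_set0; case: saM.
- move=> B; rewrite setTD => /(sigma_not saM); exact.
- move=> F MF; rewrite preimage_bigcup.
  by case: saM => _ _; apply.
Qed.

(** * Analytic sets *)

Lemma dependent_family_choice (I : Type) (T : I -> Type) (P : forall i, T i -> Prop) :
  (forall i, exists x, P i x) -> exists f : forall i, T i, forall i, P i (f i).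
Proof.
by move=> h; exists (fun i => projT1 (cid (h i))) => i; exact: projT2 (cid (h i)).
Qed.

Section Analytic.
Variables (R : realType) (X : pseudoMetricType R).

(* A presentation of a subset of [X] as the range of [value].  The limit [w] in
   [piece_limit] need not lie in the pieces [piece k (a k)]: only its value
   matters, so open sets, intersections and projections need no closedness. *)
Record souslin_scheme := SouslinScheme {
  carrier : Type;
  value : carrier -> X;
  piece : nat -> nat -> set carrier;
  piece_cover : forall n w, exists i, piece n i w;
  piece_limit : forall a : nat -> nat,
    (forall n, exists w, forall k, (k <= n)%N -> piece k (a k) w) ->
    exists w, forall e : R, 0 < e -> exists n, forall w',
      (forall k, (k <= n)%N -> piece k (a k) w') -> ball (value w) e (value w') }.

Definition analytic (A : set X) :=
  exists s : souslin_scheme, forall x, A x <-> exists w : carrier s, value w = x.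

(** Disjoint union of the schemes: level 0 of the pieces names the summand and level [k.+1] is level
    [k] inside it, so a branch stays in one summand. *)
Lemma analytic_bigcup (A : nat -> set X) :
  (forall n, analytic (A n)) -> analytic (\bigcup_n A n).
Proof.
move=> /(_ _)/cid anA; pose s n := projT1 (anA n).
have sP n : forall x, A n x <-> exists w : carrier (s n), value w = x := projT2 (anA n).
pose W := {n & carrier (s n)}.
pose U (k i : nat) : set W := fun w =>
  if k is k'.+1 then @piece (s (projT1 w)) k' i (projT2 w) else projT1 w = i.
unshelve eexists (@SouslinScheme W (fun w => @value (s (projT1 w)) (projT2 w)) U _ _).
- move=> [|k] [n w]; first by exists n.
  exact: (piece_cover k w).
- move=> a ha.
  have [n|w hw] := @piece_limit (s (a 0%N)) (fun k => a k.+1).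
    have [[m w] hw] := ha n.+1.
    have /= E := hw 0%N isT; rewrite /= in E; subst m.
    by exists w => k kn; exact: (hw k.+1).
  exists (existT _ (a 0%N) w) => e /hw[n hn]; exists n.+1 => -[m w'] /= h.
  have /= E := h 0%N isT; subst m.
  by apply: hn => k kn; exact: (h k.+1).
- move=> x; split=> [[n _ /sP[w <-]]|[[n w] <-]]; first by exists (existT _ n w).
  by exists n => //; apply/sP; exists w.
Qed.

(** With [cauchy_limit] and [q_dense] below, this says that [X] is Polish, in a form that serves
    both for a space and for its square. *)
Hypothesis ball_separated : forall x y : X, (forall e : R, 0 < e -> ball x e y) -> x = y.

(** Fibre product of the schemes: a point is a family with a common value, and the piece coded by
    [(j, l)] constrains coordinate [j] at level [l]. The limits are taken in each coordinate
    separately; their values agree because a family deep in the branch has one value, close to all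
    of them. *)
Lemma analytic_bigcap (A : nat -> set X) :
  (forall n, analytic (A n)) -> analytic (\bigcap_n A n).
Proof.
move=> /(_ _)/cid anA; pose s n := projT1 (anA n).
have sP n : forall x, A n x <-> exists w : carrier (s n), value w = x := projT2 (anA n).
pose W := {w : forall n, carrier (s n) | forall n, value (w n) = value (w 0%N)}.
pose U (k i : nat) : set W := fun w =>
  if unpickle k is Some jl then @piece (s jl.1) jl.2 i (projT1 w jl.1) else True.
pose code (j k : nat) : nat := pickle (j, k).
have Ucode (w : W) j k i : U (code j k) i w = piece k i (projT1 w j).
  by rewrite /U /code pickleK.
(* Compatibility up to level [top j n] implies compatibility of coordinate [j] up to level [n]. *)
pose top j n := (\max_(k < n.+1) code j k)%N.
have topP j n k : (k <= n)%N -> (code j k <= top j n)%N.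
  by move=> kn; exact: (@leq_bigmax _ (fun k : 'I_n.+1 => code j k) (Ordinal (n:=n.+1) (m:=k) kn)).
unshelve eexists (@SouslinScheme W (fun w => value (projT1 w 0%N)) U _ _).
- move=> k w; rewrite /U; case: (unpickle k) => [[j l]|]; last by exists 0%N.
  exact: piece_cover.
- move=> a ha.
  have [|w hw] := @dependent_family_choice nat (fun j => carrier (s j))
      (fun j w => forall e : R, 0 < e -> exists n, forall w' : carrier (s j),
      (forall k, (k <= n)%N -> piece k (a (code j k)) w') -> ball (value w) e (value w')).
    move=> j; apply: (@piece_limit (s j) (fun k => a (code j k))) => n.
    have [w hw] := ha (top j n); exists (projT1 w j) => k kn.
    by rewrite -Ucode; apply: hw; exact: topP.
  have agree j : value (w j) = value (w 0%N).
    apply: ball_separated => e e0.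
    have [n hn] := hw j _ (divr_gt0 e0 (ltr0Sn R 1)).
    have [m hm] := hw 0%N _ (divr_gt0 e0 (ltr0Sn R 1)).
    have [w' hw'] := ha (maxn (top j n) (top 0%N m)).
    have b1 : ball (value (w j)) (e / 2) (value (projT1 w' j)).
      apply: hn => k kn; rewrite -Ucode; apply: hw'.
      by rewrite leq_max topP.
    have b2 : ball (value (w 0%N)) (e / 2) (value (projT1 w' 0%N)).
      apply: hm => k kn; rewrite -Ucode; apply: hw'.
      by rewrite leq_max topP // orbT.
    rewrite (splitr e); apply: ball_triangle b1 _; rewrite (projT2 w' j).
    exact: ball_sym.
  exists (exist _ w agree) => e /(hw 0%N)[n hn]; exists (top 0%N n) => w' h /=.
  by apply: hn => k kn; rewrite -Ucode; apply: h; exact: topP.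
- move=> x; split=> [Ax|[[w hw] <-] n _].
    have [n|w hw] := @dependent_family_choice nat (fun n => carrier (s n)) (fun n w => value w = x).
      exact/sP/Ax.
    have agree j : value (w j) = value (w 0%N) by rewrite !hw.
    by exists (exist _ w agree) => /=.
  by apply/sP; exists (w n); rewrite hw.
Qed.


Lemma analytic_setI (A B : set X) : analytic A -> analytic B -> analytic (A `&` B).
Proof.
move=> anA anB; rewrite (_ : _ `&` _ = \bigcap_n if n is 0%N then A else B).
  by apply: analytic_bigcap => -[].
apply/seteqP; split=> [x [? ?] []//|x h].
by split; [exact: (h 0%N)|exact: (h 1%N)].
Qed.

Hypothesis cauchy_limit : forall u : nat -> X,
  (forall e : R, 0 < e -> exists n, forall m, (n <= m)%N -> ball (u n) e (u m)) ->
  exists l, forall e : R, 0 < e -> exists n, forall m, (n <= m)%N -> ball l e (u m).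
Variable q : nat -> X.
Hypothesis q_dense : forall x (e : R), 0 < e -> exists i, ball (q i) e x.

Definition mesh (k : nat) : R := k.+1%:R^-1.

Lemma mesh_gt0 k : 0 < mesh k.
Proof. by rewrite invr_gt0 ltr0Sn. Qed.

Lemma mesh_lt (e : R) : 0 < e -> exists k, mesh k < e.
Proof.
move=> e0; exists (Num.truncn e^-1).
by rewrite invf_plt ?posrE ?ltr0Sn //; exact: truncnS_gt.
Qed.

(** The carrier is [A] itself. Level 0 selects some [P m] and the other levels select shrinking
    balls, so a branch is Cauchy and its limit, being in the closure of [P m], stays in [A]. *)
Lemma analytic_union_closure (A : set X) (P : nat -> set X) :
  A = \bigcup_m P m -> (forall m, closure (P m) `<=` A) -> analytic A.
Proof.
move=> AE clP.
pose W := {x | A x}.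
pose U (k i : nat) : set W := fun w =>
  if k is k'.+1 then ball (q i) (mesh k') (projT1 w) else P i (projT1 w).
unshelve eexists (@SouslinScheme W (fun w => projT1 w) U _ _).
- move=> [|k] [x Ax] /=; last by apply: q_dense; exact: mesh_gt0.
  by move: (Ax); rewrite AE => -[i _ Pi]; exists i.
- move=> a /choice[u hu].
  have close e : 0 < e -> exists n, forall x, ball (q (a n.+1)) (mesh n) x ->
      forall y, ball (q (a n.+1)) (mesh n) y -> ball x e y.
    move=> e0; have [n hn] := mesh_lt (divr_gt0 e0 (ltr0Sn R 1)).
    exists n => x /ball_sym bx y hy; rewrite (splitr e).
    by apply: ball_triangle (le_ball (ltW hn) bx) (le_ball (ltW hn) hy).
  have [e e0|l hl] := cauchy_limit (u := fun n => projT1 (u n)).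
    have [n hn] := close _ e0; exists n.+1 => m nm.
    by apply: hn; [exact: (hu n.+1 n.+1)|exact: (hu m n.+1)].
  have Al : A l.
    apply: (clP (a 0%N)) => B /nbhs_ballP[e /= e0 eB].
    have [n hn] := hl _ e0; exists (projT1 (u n)); split.
      exact: (hu n 0%N).
    by apply/eB/hn.
  exists (exist _ l Al) => e e0 /=.
  have [n hn] := close _ (divr_gt0 e0 (ltr0Sn R 1)).
  have [m hm] := hl _ (divr_gt0 e0 (ltr0Sn R 1)).
  exists n.+1 => w' /(_ n.+1 (leqnn _)) /= hw'.
  rewrite (splitr e); apply: ball_triangle (hm (maxn m n.+1) (leq_maxl _ _)) _.
  by apply: hn hw'; apply: (hu _ n.+1); exact: leq_maxr.
- by move=> x; split=> [Ax|[[y Ay] <-]//]; exists (exist _ x Ax).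
Qed.

Lemma closed_analytic (A : set X) : closed A -> analytic A.
Proof.
move=> /closure_id Ac; apply: (@analytic_union_closure _ (fun=> A)).
  by rewrite bigcup_const //; exists 0%N.
by move=> _; rewrite -Ac.
Qed.

(** A limit point of the set of points whose ball of radius [mesh m] lies in [A] belongs to one of
    these balls. *)
Lemma open_analytic (A : set X) : open A -> analytic A.
Proof.
move=> Ao; apply: (@analytic_union_closure _ (fun m => [set x | ball x (mesh m) `<=` A])).
  apply/seteqP; split=> [x Ax|x [m _]]; last by apply; apply: ballxx; exact: mesh_gt0.
  have /nbhs_ballP[e /= e0 eA] : nbhs x A by rewrite nbhsE; exists A.
  have [m me] := mesh_lt e0; exists m => // y hy; apply: eA.
  exact: le_ball (ltW me) _ hy.
move=> m x /(_ _ (nbhsx_ballx x _ (mesh_gt0 m)))[y [hy /ball_sym]]; exact: hy.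
Qed.

Lemma analytic_guard (P : Prop) (A : set X) : (P -> analytic A) -> analytic (fun x => P /\ A x).
Proof.
move=> h; have [p|np] := pselect P.
  rewrite (_ : (fun x => _) = A); first exact: h.
  by apply/funext => x; apply/propext; split=> [[]|].
rewrite (_ : (fun x => _) = set0); first by apply: closed_analytic; exact: closed0.
by apply/funext => x; apply/propext; split=> // -[].
Qed.

(** The sets that are analytic together with their complement form a sigma-algebra. *)
Lemma borel_analytic : <<s @open X >> `<=` analytic.
Proof.
move=> A /(_ [set B | analytic B /\ analytic (~` B)]) [] //; split; last first.
  by move=> B Bo; split; [exact: open_analytic|apply: closed_analytic; exact: open_closedC].
split=> [|B [? ?]|F hF].
- by rewrite /= setC0; split; apply: closed_analytic; [exact: closed0|exact: closedT].
- by rewrite /= setTD setCK.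
split; first by apply: analytic_bigcup => n; case: (hF n).
by rewrite setC_bigcup; apply: analytic_bigcap => n; case: (hF n).
Qed.

(** Lusin separation. If two sets of carrier points are inseparable, so are some two of their pieces
    at any level. Descending gives two branches with limits of distinct values, but deep pieces then
    lie in disjoint balls. *)
Lemma analytic_separation (A B : set X) : analytic A -> analytic B ->
  A `&` B = set0 ->
  exists S, [/\ <<s @open X >> S, A `<=` S & S `&` B = set0].
Proof.
move=> [s sA] [t tB] AB0; apply: contrapT => nsep.
pose separated (P : set (carrier s)) (Q : set (carrier t)) :=
  exists S, [/\ <<s @open X >> S, (forall w, P w -> S (value w)) &
    (forall w, Q w -> ~ S (value w))].
have saX := sigma_generated (@open X).
have split_separated n (pq : set (carrier s) * set (carrier t)) :
    exists ij : nat * nat, ~ separated pq.1 pq.2 ->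
    ~ separated (pq.1 `&` @piece s n ij.1) (pq.2 `&` @piece t n ij.2).
  apply: contrapT => /forallNP h.
  have [hs|hs] := pselect (separated pq.1 pq.2).
    by apply: (h (0, 0)%N) => /(_ hs).
  have {}h ij : separated (pq.1 `&` @piece s n ij.1) (pq.2 `&` @piece t n ij.2).
    by apply: contrapT => h'; apply: (h ij).
  have /choice[S hS] := h; apply: hs.
  (* If all pairs of pieces are separated by [S (i, j)], the union over [i] of the intersections
     over [j] separates the whole. *)
  exists (fun x => exists i, forall j, S (i, j) x); split.
  - apply: (sigma_ex saX) => i; apply: (sigma_all saX) => j.
    by case: (hS (i, j)).
  - move=> w Pw; have [i wi] := piece_cover n w; exists i => j.
    by have [_ + _] := hS (i, j); apply.
  - move=> w Qw [i]; have [j wj] := piece_cover n w => /(_ j).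
    by have [_ _] := hS (i, j); apply.
have /choice[f hf] : forall npq : nat * (set (carrier s) * set (carrier t)),
    exists ij : nat * nat, ~ separated npq.2.1 npq.2.2 ->
    ~ separated (npq.2.1 `&` @piece s npq.1 ij.1) (npq.2.2 `&` @piece t npq.1 ij.2).
  by move=> [n pq]; exact: split_separated.
pose st := fix st n : set (carrier s) * set (carrier t) :=
  if n is m.+1 then ((st m).1 `&` @piece s m (f (m, st m)).1,
                     (st m).2 `&` @piece t m (f (m, st m)).2)
  else (setT, setT).
have stN n : ~ separated (st n).1 (st n).2.
  elim: n => [[S [mS hP hQ]]|n /(hf (n, st n)) //].
  apply: nsep; exists S; split => //.
    by move=> x /sA[w <-]; exact: hP.
  by apply/seteqP; split => // x [Sx /tB[w E]]; apply: (hQ w) => //; rewrite E.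
have st1 n w : (forall k, (k < n)%N -> @piece s k (f (k, st k)).1 w) <-> (st n).1 w.
  elim: n => [|n IH]; first by split.
  split=> [h|[/IH h hn] k]; last by rewrite ltnS leq_eqVlt => /predU1P[->//|/h].
  by split; [apply/IH => k kn; apply: h; exact: ltnW|exact: h].
have st2 n w : (forall k, (k < n)%N -> @piece t k (f (k, st k)).2 w) <-> (st n).2 w.
  elim: n => [|n IH]; first by split.
  split=> [h|[/IH h hn] k]; last by rewrite ltnS leq_eqVlt => /predU1P[->//|/h].
  by split; [apply/IH => k kn; apply: h; exact: ltnW|exact: h].
(* The branches are never empty: an empty side would be separated by [set0] or [setT]. *)
have [n|w hw] := piece_limit (s := s) (a := fun k => (f (k, st k)).1).
  apply: contrapT => /forallNP h; apply: (stN n.+1).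
  exists set0; split; [exact: sigma_algebra0| |by move=> ? _ []].
  by move=> w /st1 hw; case: (h w) => k; rewrite -ltnS; exact: hw.
have [n|w' hw'] := piece_limit (s := t) (a := fun k => (f (k, st k)).2).
  apply: contrapT => /forallNP h; apply: (stN n.+1).
  exists setT; split; [exact: (sigma_const saX True)|by []|].
  by move=> w' /st2 hw' _; case: (h w') => k; rewrite -ltnS; exact: hw'.
have [e e0 ww'] : exists2 e : R, 0 < e & ~ ball (value w) e (value w').
  apply: contrapT => h.
  have E : value w = value w'.
    by apply: ball_separated => e e0; apply: contrapT => ?; apply: h; exists e.
  suff : (A `&` B) (value w) by rewrite AB0.
  by split; [apply/sA; exists w|apply/tB; exists w'].
have e2 : 0 < e / 2 by rewrite divr_gt0.
have e4 : 0 < e / 2 / 2 by rewrite divr_gt0.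
have [n hn] := hw _ e4; have [m hm] := hw' _ e2.
apply: (stN (maxn n m).+1); exists (interior (ball (value w) (e / 2))); split.
- by apply: sub_sigma_algebra; exact: open_interior.
- move=> u /st1 hu; apply/nbhs_ballP; exists (e / 2 / 2) => //= y.
  rewrite [in ball (value w) _](splitr (e / 2)); apply: ball_triangle; apply: hn => k kn.
  by apply: hu; rewrite ltnS leq_max kn.
- move=> u /st2 hu /interior_subset bu; apply: ww'; rewrite (splitr e).
  apply: ball_triangle bu _; apply/ball_sym/hm => k km.
  by apply: hu; rewrite ltnS leq_max km orbT.
Qed.

End Analytic.

(** * Substitution in Borel relations and coordinate projections *)

Lemma borel_relation_sub (X V : Type) (M : set_system X) (B : set_system V)
    (E : V -> V -> Prop) (g h : X -> V) :
  sigma_algebra setT M -> measurable_map M B g -> measurable_map M B h ->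
  borel_relation B E -> M (fun x => E (g x) (h x)).
Proof.
move=> saM mg mh BE.
apply: (measurable_map_generated (g := fun x => (g x, h x)) saM _ BE).
move=> _ [P BP [Q BQ <-]].
by apply: (sigma_and saM); [exact: mg|exact: mh].
Qed.


Lemma measurable_map_fst (V : Type) (B : set_system V) : sigma_algebra setT B ->
  measurable_map <<s [set A `*` A' | A in B & A' in B] >> B fst.
Proof.
move=> saB A BA; apply: sub_sigma_algebra; exists A => //; exists setT.
  exact: (sigma_const saB True).
by apply/seteqP; split=> [p []//|p /= ?]; split.
Qed.

Lemma measurable_map_snd (V : Type) (B : set_system V) : sigma_algebra setT B ->
  measurable_map <<s [set A `*` A' | A in B & A' in B] >> B snd.
Proof.
move=> saB A BA; apply: sub_sigma_algebra; exists setT; first exact: (sigma_const saB True).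
by exists A => //; apply/seteqP; split=> [p []//|p /= ?]; split.
Qed.

(** * Finite codes from a countable separating family *)

Section Patterns.
Variables (V : choiceType) (U : nat -> set V).

(** The first [n] digits of the code of [x] in Cantor space. *)
Definition pattern (n : nat) (x : V) : seq bool := mkseq (fun j => `[< U j x >]) n.

Lemma size_pattern n x : size (pattern n x) = n.
Proof. exact: size_mkseq. Qed.

Lemma pattern_eq n x s : pattern n x = s <->
  size s = n /\ forall j, (j < n)%N -> (nth false s j <-> U j x).
Proof.
split=> [<-|[sn h]].
  split=> [|j jn]; first exact: size_pattern.
  by rewrite nth_mkseq //; split=> /asboolP.
apply: (@eq_from_nth _ false); first by rewrite size_pattern.
move=> j; rewrite size_pattern => jn; rewrite nth_mkseq //.
by apply/asboolP/idP => /h; apply.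
Qed.

Hypothesis separating : forall x y, x != y -> exists j, U j x /\ ~ U j y.

Lemma pattern_separates x (l : seq V) : exists n, forall m y, (n <= m)%N ->
  y \in l -> pattern m x = pattern m y -> x = y.
Proof.
elim: l => [|z l [n hn]]; first by exists 0%N.
have [xz|/separating[j [Ux nUz]]] := eqVneq x z.
  by exists n => m y nm; rewrite inE => /predU1P[->//|]; exact: hn.
(* Digit [j] is part of a pattern of length [m] only when [j < m]. *)
exists (maxn n j.+1) => m y; rewrite geq_max => /andP[nm jm].
rewrite inE => /predU1P[->|]; last exact: hn.
by move=> /pattern_eq[_ /(_ j jm)]; rewrite nth_mkseq // => -[_ /(_ Ux)/asboolP].
Qed.

Lemma pattern_injective (l : seq V) : exists n, {in l &, injective (pattern n)}.
Proof.
have /choice[f hf] x := pattern_separates x l.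
exists (\max_(x <- l) f x)%N => x y xl yl; apply: hf => //.
exact: leq_bigmax_seq.
Qed.

Lemma pattern_measurable (B : set_system V) n s : sigma_algebra setT B ->
  (forall j, B (U j)) -> B (fun x => pattern n x = s).
Proof.
move=> saB BU; rewrite (_ : (fun x => _) = fun x => size s = n /\
   forall j, (j < n)%N -> (nth false s j -> U j x) /\ (U j x -> nth false s j)).
  apply: (sigma_and saB); first exact: sigma_const.
  apply: (sigma_all saB) => j; apply: (sigma_imp saB); first exact: sigma_const.
  by apply: (sigma_and saB); apply: (sigma_imp saB) => //; exact: sigma_const.
by apply/funext => x; apply/propext; rewrite pattern_eq.
Qed.

End Patterns.

(** * Borel relations with finite sections *)

Section Polish.
Variables (R : realType) (T : metricType R).
Hypothesis T_complete : complete_metric T.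
Variable q : nat -> T.
Hypothesis q_dense : forall x (e : R), 0 < e -> exists i, ball (q i) e x.

Let borel : set_system T := <<s @open T >>.
Let sa_borel : sigma_algebra setT borel := sigma_generated (@open T).
Let borel2 : set_system (T * T) := <<s [set A `*` A' | A in borel & A' in borel] >>.
Let sa_borel2 : sigma_algebra setT borel2 := sigma_generated _.

Lemma metric_ball_separated (x y : T) : (forall e : R, 0 < e -> ball x e y) -> x = y.
Proof.
move=> h; apply: mdist_positivity; apply/eqP; rewrite eq_le mdist_ge0 andbT leNgt.
by apply/negP => /h; rewrite ballEmdist /= ltxx.
Qed.

Lemma metric_cauchy_limit (u : nat -> T) :
  (forall e : R, 0 < e -> exists n, forall m, (n <= m)%N -> ball (u n) e (u m)) ->
  exists l, forall e : R, 0 < e -> exists n, forall m, (n <= m)%N -> ball l e (u m).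
Proof.
move=> cu; have cF : cauchy (u @ \oo).
  apply/cauchyP => e e0; have [n hn] := cu _ e0.
  by exists (u n); exists n.
have [l ul] := T_complete _ cF; exists l => e e0.
by have [n _ hn] := cvg_ball ul e0; exists n => m nm; exact: hn.
Qed.

Lemma prod_ball_separated (x y : T * T) :
  (forall e : R, 0 < e -> ball x e y) -> x = y.
Proof.
by move: x y => [x1 x2] [y1 y2] h; congr pair; apply: metric_ball_separated => e /h[].
Qed.

Lemma prod_cauchy_limit (u : nat -> T * T) :
  (forall e : R, 0 < e -> exists n, forall m, (n <= m)%N -> ball (u n) e (u m)) ->
  exists l, forall e : R, 0 < e -> exists n, forall m, (n <= m)%N -> ball l e (u m).
Proof.
move=> cu.
have [e /cu[n hn]|l1 h1] := metric_cauchy_limit (u := fun n => (u n).1).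
  by exists n => m /hn[].
have [e /cu[n hn]|l2 h2] := metric_cauchy_limit (u := fun n => (u n).2).
  by exists n => m /hn[].
exists (l1, l2) => e e0; have [n hn] := h1 _ e0; have [m hm] := h2 _ e0.
by exists (maxn n m) => k; rewrite geq_max => /andP[/hn ? /hm ?].
Qed.

Let q2 n : T * T := if unpickle n is Some ij then (q ij.1, q ij.2) else (q 0, q 0).

Lemma prod_dense (x : T * T) (e : R) : 0 < e -> exists i, ball (q2 i) e x.
Proof.
move=> e0; have [i hi] := q_dense x.1 e0; have [j hj] := q_dense x.2 e0.
by exists (pickle (i, j)); rewrite /q2 pickleK; split.
Qed.

(** Rectangles with Borel sides are Borel in the product topology, as the projections are
    continuous. *)
Lemma borel2_analytic : borel2 `<=` @analytic R (T * T)%type.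
Proof.
apply: subset_trans (borel_analytic prod_ball_separated prod_cauchy_limit prod_dense).
have sa := sigma_generated (@open (T * T)%type).
apply: smallest_sub => // _ [A mA [A' mA' <-]].
apply: (sigma_and sa).
  apply: (measurable_map_generated sa _ mA) => O oO.
  apply: sub_sigma_algebra; apply: open_comp oO => p _; exact: cvg_fst.
apply: (measurable_map_generated sa _ mA') => O oO.
by apply: sub_sigma_algebra; apply: open_comp oO => p _; exact: cvg_snd.
Qed.

(** The scheme of [P] is kept with only the first coordinate of its values; limits survive since
    product balls project into balls. *)
Lemma analytic_proj (P : set (T * T)) : borel2 P -> analytic (fun x => exists y, P (x, y)).
Proof.
move=> /borel2_analytic[s sP].
unshelve eexists (@SouslinScheme R T (carrier s) (fun w => (value w).1)
  (@piece _ _ s) (@piece_cover _ _ s) _).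
- by move=> a /piece_limit[w hw]; exists w => e /hw[n hn]; exists n => w' /hn[].
- move=> x; split=> [[y /sP[w E]]|[w <-]]; first by exists w; rewrite /= E.
by exists (@value _ _ s w).2; apply/sP; exists w => /=; case: (@value _ _ s w).
Qed.

Lemma borel_interior_ball x (e : R) : borel (interior (ball x e)).
Proof. by apply: sub_sigma_algebra; exact: open_interior. Qed.

(* For each ball of a fixed small radius, the points whose [K]-value lies inside
   and outside it form disjoint analytic sets.  Borel separators select, for
   every [x], a ball of each radius, and [g x] is the limit of their centres. *)
Lemma extend_functional (K : T -> T -> Prop) :
  (forall x y y', K x y -> K x y' -> y = y') ->
  (forall U, borel U -> analytic (fun x => exists2 y, U y & K x y)) ->
  exists2 g : T -> T, measurable_map borel borel g & forall x y, K x y -> g x = y.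
Proof.
move=> funK anK.
pose U (n i : nat) := interior (ball (q i) (mesh R n)).
have /choice[S hS] : forall ni : nat * nat, exists S : set T,
    borel S /\ forall x y, K x y -> S x <-> U ni.1 ni.2 y.
  move=> [n i]; have mU := borel_interior_ball (q i) (mesh R n).
  have [|S [mS S1 S2]] := analytic_separation metric_ball_separated
    (anK _ mU) (anK _ (sigma_not sa_borel mU)).
    apply/seteqP; split => // x [[y Uy Kxy] [y' nUy' Kxy']].
    by apply: nUy'; rewrite (funK _ _ _ Kxy' Kxy).
  exists S; split => // x y Kxy; split => [Sx|Uy]; last by apply: S1; exists y.
  apply: contrapT => nUy; suff : (set0 : set T) x by [].
  by rewrite -S2; split => //; exists y.
(* Among the balls of radius [mesh R n] whose separator contains [x], the one of least index is
   selected. *)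
pose first n i : set T := fun x => S (n, i) x /\ forall j : nat, (j < i)%N -> ~ S (n, j) x.
have mfirst n i : borel (first n i).
  apply: (sigma_and sa_borel); first by case: (hS (n, i)).
  apply: (sigma_all sa_borel) => j; apply: (sigma_imp sa_borel).
    exact: (sigma_const sa_borel).
  by apply: (sigma_not sa_borel); case: (hS (n, j)).
have first_uniq n i j x : first n i x -> first n j x -> i = j.
  move=> [Si hi] [Sj hj].
  by have [/hj|/hi|] := ltngtP i j.
(* The selected centres exist from some stage on and form a Cauchy sequence. Outside the domain of
   [K] this may fail, and [g] then defaults to [q 0]. *)
pose conv : set T := fun x => forall k, exists N, forall n, (N <= n)%N ->
  exists i j : nat, first n i x /\ first N j x /\ ball (q j) (mesh R k) (q i).
have mconv : borel conv.
  apply: (sigma_all sa_borel) => k; apply: (sigma_ex sa_borel) => N.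
  apply: (sigma_all sa_borel) => n; apply: (sigma_imp sa_borel).
    exact: (sigma_const sa_borel).
  apply: (sigma_ex sa_borel) => i; apply: (sigma_ex sa_borel) => j.
  do 2!apply: (sigma_and sa_borel) => //; exact: (sigma_const sa_borel).
have /choice[g hg] : forall x, exists l, (conv x -> forall e : R, 0 < e ->
      exists N, forall n, (N <= n)%N -> exists2 i, first n i x & ball l e (q i)) /\
    (~ conv x -> l = q 0%N).
  move=> x; have [cx|ncx] := pselect (conv x); last by exists (q 0%N); split.
  have /choice[c hc] : forall n, exists i, (exists i, first n i x) -> first n i x.
    by move=> n; have [[i hi]|no] := pselect (exists i, first n i x); [exists i|exists 0%N].
  have [e e0|l hl] := metric_cauchy_limit (u := fun n => q (c n)).
    have [k ke] := mesh_lt e0; have [N hN] := cx k; exists N => n /hN[i [j [fi [fj b]]]].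
    rewrite (first_uniq _ _ _ _ (hc _ (ex_intro _ i fi)) fi).
    rewrite (first_uniq _ _ _ _ (hc _ (ex_intro _ j fj)) fj).
    exact: le_ball (ltW ke) _ b.
  exists l; split => // _ e e0; have [m hm] := hl _ e0; have [N hN] := cx 0%N.
  exists (maxn m N) => n; rewrite geq_max => /andP[/hm b /hN[i [_ [fi _]]]].
  by exists (c n) => //; apply: hc; exists i.
exists g.
  apply: (measurable_map_generated sa_borel) => O oO.
  (* On [conv], the limit is in [O] iff balls of one fixed radius around all late centres lie in
     [O]. *)
  rewrite (_ : _ @^-1` _ = fun x => (~ conv x /\ O (q 0%N)) \/ (conv x /\ exists k N : nat,
      forall n, (N <= n)%N -> exists i, first n i x /\ ball (q i) (mesh R k) `<=` O)).
    apply: (sigma_or sa_borel); apply: (sigma_and sa_borel) => //.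
    - exact: (sigma_not sa_borel).
    - exact: (sigma_const sa_borel).
    apply: (sigma_ex sa_borel) => k; apply: (sigma_ex sa_borel) => N.
    apply: (sigma_all sa_borel) => n; apply: (sigma_imp sa_borel).
      exact: (sigma_const sa_borel).
    apply: (sigma_ex sa_borel) => i; apply: (sigma_and sa_borel) => //.
    exact: (sigma_const sa_borel).
  apply/funext => x; apply/propext; have [cx|ncx] := pselect (conv x); last first.
    rewrite /preimage/= (hg x).2 //; split=> [?|[[]//|[]//]]; by left.
  have {}hg := (hg x).1 cx; split=> [Ogx|[[]//|[_ [k [N hN]]]]].
    right; split => //.
    have /nbhs_ballP[e /= e0 eO] : nbhs (g x) O by rewrite nbhsE; exists O.
    have e2 : 0 < e / 2 by rewrite divr_gt0.
    have [k ke] := mesh_lt e2; have [N hN] := hg _ e2.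
    exists k, N => n /hN[i fi b]; exists i; split => // y hy; apply: eO.
    by rewrite (splitr e); apply: ball_triangle b (le_ball (ltW ke) hy).
  have [M hM] := hg _ (mesh_gt0 R k).
  have [i fi b] := hM _ (leq_maxl M N); have [j [fj]] := hN _ (leq_maxr M N); apply.
  by rewrite -(first_uniq _ _ _ _ fi fj); exact: ball_sym.
move=> x y Kxy.
(* If [K x y], the separators at [x] tell exactly which balls contain [y], so the centre selected at
   stage [n] is close to [y]. *)
have close n : exists i, first n i x /\ ball (q i) (mesh R n) y.
  have ex : exists i, `[< S (n, i) x >].
    have [i hi] := q_dense y (divr_gt0 (mesh_gt0 R n) (ltr0Sn R 1)).
    exists i; apply/asboolP/((hS (n, i)).2 _ _ Kxy)/nbhs_ballP.
    exists (mesh R n / 2); first by rewrite /= divr_gt0 // mesh_gt0.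
    by move=> z /= yz; rewrite (splitr (mesh R n)); exact: ball_triangle hi yz.
  case: (ex_minnP ex) => i /asboolP Si mini; exists i; split.
    split=> // j ji Sj; move: ji; rewrite ltnNge; apply/negP/negPn.
    by apply: mini; exact/asboolP.
  exact: (interior_subset (((hS (n, i)).2 _ _ Kxy).1 Si)).
have mesh_le m n : (m <= n)%N -> mesh R n <= mesh R m.
  by move=> mn; rewrite lef_pV2 ?posrE ?ltr0Sn // ler_nat.
have cx : conv x.
  move=> k; have [N hN] := mesh_lt (divr_gt0 (mesh_gt0 R k) (ltr0Sn R 1)).
  exists N => n Nn; have [i [fi bi]] := close n; have [j [fj bj]] := close N.
  exists i, j; split => //; split => //; rewrite (splitr (mesh R k)).
  apply: ball_triangle (le_ball (ltW hN) bj) _; apply: ball_sym.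
  exact: le_ball (le_trans (mesh_le _ _ Nn) (ltW hN)) _ bi.
apply: metric_ball_separated => e e0; have e2 : 0 < e / 2 by rewrite divr_gt0.
have [N hN] := (hg x).1 cx _ e2; have [k ke] := mesh_lt e2.
have [i fi b] := hN _ (leq_maxl N k); have [j [fj bj]] := close (maxn N k).
rewrite (first_uniq _ _ _ _ fi fj) in b.
rewrite (splitr e); apply: ball_triangle b _.
by apply: le_ball _ bj; apply: le_trans (mesh_le _ _ (leq_maxr N k)) (ltW ke).
Qed.


Lemma countable_separating : exists U : nat -> set T, (forall m, borel (U m)) /\
  forall x y, x != y -> exists m, U m x /\ ~ U m y.
Proof.
pose base (m : nat) : set T :=
  if unpickle m is Some ni then interior (ball (q ni.2) (mesh R ni.1)) else set0.
exists base; split=> [m|x y xy].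
  rewrite /base; case: (unpickle m) => [ni|]; first exact: borel_interior_ball.
  exact: sigma_algebra0.
apply: contrapT => /forallNP h; move/eqP: xy; apply.
apply: metric_ball_separated => e e0; have e2 : 0 < e / 2 by rewrite divr_gt0.
have [n ne] := mesh_lt e2.
have [i hi] := q_dense x (divr_gt0 (mesh_gt0 R n) (ltr0Sn R 1)).
have bx : interior (ball (q i) (mesh R n)) x.
  apply/nbhs_ballP; exists (mesh R n / 2); first by rewrite /= divr_gt0 // mesh_gt0.
  by move=> z /= yz; rewrite (splitr (mesh R n)); exact: ball_triangle hi yz.
have by_ : interior (ball (q i) (mesh R n)) y.
  apply: contrapT => nby; apply: (h (pickle (n, i))).
  by rewrite /base pickleK.
rewrite (splitr e); apply: (@ball_triangle _ _ (q i)); last first.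
  exact: le_ball (ltW ne) _ (interior_subset by_).
apply: ball_sym; exact: le_ball (ltW ne) _ (interior_subset bx).
Qed.

Lemma borel2_fst A : borel A -> borel2 (fun p => A p.1).
Proof. by move=> /(measurable_map_fst sa_borel). Qed.

Lemma borel2_snd A : borel A -> borel2 (fun p => A p.2).
Proof. by move=> /(measurable_map_snd sa_borel). Qed.

(* Where the section has the maximal size [k.+1], it is cut into singletons by
   finitely many disjoint Borel sets.  Each singleton is an analytic functional
   relation, extended by [extend_functional] to a total Borel map, which
   shows that the set of such [x] is Borel; off it, sections have size at
   most [k]. *)
Theorem borel_finite_sections k (H : T -> T -> Prop) :
  borel_relation borel H ->
  (forall x (l : seq T), uniq l -> (forall y, y \in l -> H x y) -> (size l <= k)%N) ->
  exists (I : countType) (F : I -> T -> T),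
    (forall i, measurable_map borel borel (F i)) /\
    forall x y, H x y -> exists i, F i x = y.
Proof.
have [base [base_borel base_separating]] := countable_separating.
elim: k H => [|k IH] H bH kH.
  exists nat, (fun _ x => x); split=> [_|x y Hxy]; first exact: measurable_map_id.
  suff : (size [:: y] <= 0)%N by [].
  by apply: (kH x) => // z; rewrite inE => /eqP->.
pose pat := pattern base.
have pat_borel n s : borel (fun y => pat n y = s).
  by apply: pattern_measurable => //; exact: base_borel.
(* As sections have at most [k.+1] points, each of these patterns is realised once, and no other
   point is in the section. *)
pose full (n : nat) (S : seq (seq bool)) x :=
  uniq S /\ size S = k.+1 /\ forall s, s \in S -> exists y, H x y /\ pat n y = s.
have fullP n S x : full n S x -> exists l : seq T,
    [/\ uniq l, size l = k.+1, map (pat n) l = S, {in l &, injective (pat n)} &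
     forall y, y \in l <-> H x y].
  move=> [uS [sS hS]].
  have /choice[c hc] : forall s, exists y, s \in S -> H x y /\ pat n y = s.
    move=> s; have [sS'|_] := boolP (s \in S); last by exists x.
    by have [y] := hS _ sS'; exists y.
  have patc : map (pat n) (map c S) = S.
    by rewrite -map_comp -[RHS]map_id; apply/eq_in_map => s /hc[].
  have ul : uniq (map c S) by apply: (@map_uniq _ _ (pat n)); rewrite patc.
  exists (map c S); split; rewrite ?size_map //.
    by move=> _ _ /mapP[s /hc[_ E] ->] /mapP[s' /hc[_ E'] ->]; rewrite E E' => ->.
  move=> y; split=> [/mapP[s /hc[Hs _] ->]//|Hxy].
  apply: contrapT => /negP yl.
  suff : (k.+2 <= k.+1)%N by rewrite ltnn.
  rewrite -[in k.+2]sS -(size_map c) -[X in (X <= _)%N]/(size (y :: map c S)).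
  apply: (kH x); first by rewrite /= yl.
  by move=> z; rewrite inE => /predU1P[->//|/mapP[s sS' ->]]; case: (hc _ sS').
pose K (n : nat) (S : seq (seq bool)) (s : seq bool) x y :=
  full n S x /\ s \in S /\ H x y /\ pat n y = s.
have saT := sa_borel2; have sa := sa_borel.
have H_borel2 n s : borel2 (fun p => H p.1 p.2 /\ pat n p.2 = s).
  apply: (sigma_and saT) => //; exact: (borel2_snd (pat_borel n s)).
have full_analytic n S : analytic (full n S).
  apply: (analytic_guard metric_cauchy_limit q_dense) => uS.
  apply: (analytic_guard metric_cauchy_limit q_dense) => sS.
  rewrite (_ : (fun x => _) = \bigcap_i if (i < size S)%N
      then fun x => exists y, H x y /\ pat n y = nth [::] S i else setT).
    apply: (analytic_bigcap metric_ball_separated) => i; case: ifP => _.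
      by apply: (analytic_proj (H_borel2 _ _)).
    by apply: (closed_analytic metric_cauchy_limit q_dense); exact: closedT.
  apply/seteqP; split=> [x h i _|x h s sS'].
    by case: ifP => // iS; apply: h; exact: mem_nth.
  by have := h (index s S) I; rewrite index_mem sS' nth_index.
have /choice[g hg] : forall nSs : nat * seq (seq bool) * seq bool, exists g : T -> T,
    measurable_map borel borel g /\ forall x y, K nSs.1.1 nSs.1.2 nSs.2 x y -> g x = y.
  move=> [[n S] s] /=.
  have [x y y' [fx [sS [Hy py]]] [_ [_ [Hy' py']]]|U mU|g mg hK] :=
      @extend_functional (K n S s); last by exists g.
    have [l [_ _ _ injl hl]] := fullP _ _ _ fx.
    by apply: injl; [exact/hl|exact/hl|rewrite py].
  have -> : (fun x => exists2 y, U y & K n S s x y) = full n S `&` (fun x => (s \in S) /\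
      exists y, (H x y /\ pat n y = s) /\ U y).
    apply/seteqP; split=> [x [y Uy [fx [sS' [Hxy py]]]]|x [fx [sS' [y [[Hxy py] Uy]]]]].
      by split=> //; split=> //; exists y.
    by exists y.
  apply: (analytic_setI metric_ball_separated) => //.
  apply: (analytic_guard metric_cauchy_limit q_dense) => _.
  apply: (analytic_proj (P := fun p => (H p.1 p.2 /\ pat n p.2 = s) /\ U p.2)).
  by apply: (sigma_and saT) => //; exact: (borel2_snd mU).
(* Replacing the witnesses in [full], which is only known to be analytic, by values of the Borel
   maps [g] turns it into a Borel condition. *)
pose P x := exists n S, uniq S /\ size S = k.+1 /\
  forall s, s \in S -> H x (g (n, S, s) x) /\ pat n (g (n, S, s) x) = s.
have fullE x : P x <-> exists n S, full n S x.
  split=> [[n [S [uS [sS h]]]]|[n [S fx]]]; exists n, S.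
    by split=> //; split=> // s /h ?; exists (g (n, S, s) x).
  have [uS [sS h]] := fx; split => //; split => // s sS'.
  have [y [Hxy pys]] := h s sS'.
  by rewrite ((hg (n, S, s)).2 x y).
have mP : borel P.
  apply: (sigma_ex sa) => n; apply: (sigma_ex sa) => S.
  apply: (sigma_guard sa) => uS; apply: (sigma_guard sa) => sS.
  apply: (sigma_all sa) => s; apply: (sigma_imp sa); first exact: sigma_const.
  have [mg _] := hg (n, S, s); apply: (sigma_and sa).
    exact: borel_relation_sub bH.
  exact: mg (pat_borel n s).
(* Off [P] a section has at most [k] points: long enough patterns would tell [k.+1] of them
   apart. *)
have [||I [F [mF hF]]] := IH (fun x y => H x y /\ ~ P x).
- by apply: (sigma_and saT) => //; exact: (borel2_fst (sigma_not sa mP)).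
- move=> x l ul hl; rewrite leqNgt; apply/negP => kl.
  case: l ul hl kl => [//|y l] ul hl kl; have [_] := hl y (mem_head _ _); apply.
  apply/fullE; have [n hn] := pattern_injective base_separating (y :: l).
  exists n, (map (pat n) (y :: l)); split; first by rewrite map_inj_in_uniq.
  split; last by move=> s /mapP[z /hl[Hz _] ->]; exists z.
  apply/eqP; rewrite size_map eqn_leq kl andbT; apply: (kH x) => // z /hl[] //.
exists (I + (nat * seq (seq bool) * seq bool))%type,
  (fun i => match i with inl i => F i | inr j => g j end); split.
  by move=> [i|j]; [exact: mF|case: (hg j)].
move=> x y Hxy; have [Px|nPx] := pselect (P x); last first.
  by have [//|i Fi] := hF x y; exists (inl i).
move/fullE: Px => [n [S fx]]; exists (inr (n, S, pat n y)) => /=.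
apply: (hg (n, S, pat n y)).2; split => //; split => //.
have [l [_ _ <- _ hl]] := fullP _ _ _ fx.
by apply/map_f/hl.
Qed.

End Polish.

(** * Borel locally finite metrics *)

Lemma nat_least (P : nat -> Prop) : (exists n, P n) ->
  exists n, P n /\ forall j, (j < n)%N -> ~ P j.
Proof.
move=> [n Pn]; have ex : exists n, `[< P n >] by exists n; apply/asboolP.
case: (ex_minnP ex) => m /asboolP Pm mini; exists m; split => // j jm Pj.
by move: jm; rewrite ltnNge mini //; exact/asboolP.
Qed.

Lemma eventually_on_seq (V : eqType) (l : seq V) (P : nat -> V -> Prop) :
  (forall m n x, (m <= n)%N -> P m x -> P n x) ->
  (forall x, x \in l -> exists n, P n x) -> exists n, forall x, x \in l -> P n x.
Proof.
move=> mono; elim: l => [|x l IH] h; first by exists 0%N.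
have [|n hn] := IH; first by move=> y yl; apply: h; rewrite inE yl orbT.
have [m hm] := h x (mem_head _ _); exists (maxn m n) => y.
rewrite inE => /predU1P[->|/hn]; first exact: mono (leq_maxl _ _) hm.
by apply: mono; exact: leq_maxr.
Qed.

Section BorelBalls.
Variables (V : choiceType) (B : set_system V).
Hypothesis saB : sigma_algebra setT B.
Variable U : nat -> set V.
Hypothesis BU : forall j, B (U j).
Hypothesis separating : forall x y, x != y -> exists j, U j x /\ ~ U j y.
(** [near r] stands for distance at most [r], and [F w] follows a word [w] of moves. By [nearE] a
    quantifier over a ball ranges over countably many words. *)
Variables (near : nat -> V -> V -> Prop) (F : seq nat -> V -> V).
Hypothesis F_measurable : forall w, measurable_map B B (F w).
Hypothesis nearE : forall r x y, near r x y <-> exists w, (size w <= r)%N /\ F w x = y.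
Hypothesis near_refl : forall r x, near r x x.
Hypothesis near_sym : forall r x y, near r x y -> near r y x.
Hypothesis near_trans : forall r s x y z, near r x y -> near s y z -> near (r + s) x z.
Hypothesis near_le : forall r s x y, (r <= s)%N -> near r x y -> near s x y.

Let prod_sigma : set_system (V * V) := <<s [set A `*` A' | A in B & A' in B] >>.
Let sa_prod : sigma_algebra setT prod_sigma := sigma_generated _.

(** * Borel quantifiers over balls *)

Section Measurability.
Variables (X : Type) (M : set_system X).
Hypothesis saM : sigma_algebra setT M.

Lemma sigma_eq (g h : X -> V) : measurable_map M B g -> measurable_map M B h ->
  M (fun x => g x = h x).
Proof.
move=> mg mh; rewrite (_ : (fun x => _) = fun x => forall j, U j (g x) -> U j (h x)).
  by apply: (sigma_all saM) => j; apply: (sigma_imp saM); [exact: mg|exact: mh].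
apply/funext => x; apply/propext; split=> [->//|h'].
apply/eqP; apply: contrapT => /negP/separating[j [gj hj]]; exact/hj/h'.
Qed.

Lemma sigma_near r (g h : X -> V) : measurable_map M B g -> measurable_map M B h ->
  M (fun x => near r (g x) (h x)).
Proof.
move=> mg mh.
rewrite (_ : (fun x => _) = fun x => exists w, (size w <= r)%N /\ F w (g x) = h x).
  apply: (sigma_ex saM) => w; apply: (sigma_and saM); first exact: sigma_const.
  by apply: sigma_eq mh; exact: measurable_map_comp mg (F_measurable w).
by apply/funext => x; apply/propext; exact: nearE.
Qed.

Lemma sigma_ex_near r (g : X -> V) (P : X -> V -> Prop) : measurable_map M B g ->
  (forall h, measurable_map M B h -> M (fun x => P x (h x))) ->
  M (fun x => exists y, near r (g x) y /\ P x y).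
Proof.
move=> mg mP.
rewrite (_ : (fun x => _) = fun x => exists w, (size w <= r)%N /\ P x (F w (g x))).
  apply: (sigma_ex saM) => w; apply: (sigma_and saM); first exact: sigma_const.
  by apply: mP; exact: measurable_map_comp mg (F_measurable w).
apply/funext => x; apply/propext; split=> [[y [/nearE[w [wr <-]] Py]]|[w [wr Pw]]].
  by exists w.
by exists (F w (g x)); split => //; apply/nearE; exists w.
Qed.

Lemma sigma_all_near r (g : X -> V) (P : X -> V -> Prop) : measurable_map M B g ->
  (forall h, measurable_map M B h -> M (fun x => P x (h x))) ->
  M (fun x => forall y, near r (g x) y -> P x y).
Proof.
move=> mg mP.
rewrite (_ : (fun x => _) = fun x => ~ exists y, near r (g x) y /\ ~ P x y).
  apply: (sigma_not saM); apply: sigma_ex_near => // h mh.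
  by apply: (sigma_not saM); exact: mP.
apply/funext => x; apply/propext; split=> [h [y [/h Py]]//|h y xy].
by apply: contrapT => nPy; apply: h; exists y.
Qed.

End Measurability.

(** * Borel colourings, discrete sets and packing *)

Variable enum : nat -> V -> seq V.
Hypothesis enum_uniq : forall r x, uniq (enum r x).
Hypothesis mem_enum : forall r x y, y \in enum r x <-> near r x y.

(** The colour of [x] encodes its shortest pattern shared by no other point of its [L]-ball; it
    determines both the pattern and its length. *)
Lemma borel_coloring L : exists c : V -> nat, (forall n, B (fun x => c x = n)) /\
  forall x y, near L x y -> c x = c y -> x = y.
Proof.
pose pat := pattern U.
pose sep n x := forall y, near L x y -> pat n x = pat n y -> x = y.
pose col x m := exists n : nat, (sep n x /\ forall j : nat, (j < n)%N -> ~ sep j x) /\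
  pickle (pat n x) = m.
have /choice[c hc] : forall x, exists m, col x m.
  move=> x; have [|n hn] := @nat_least (fun n => sep n x);
    last by exists (pickle (pat n x)); exists n.
  have [n hn] := pattern_separates separating x (enum L x); exists n => y /mem_enum.
  exact: hn.
have col_uniq x m m' : col x m -> col x m' -> m = m'.
  move=> [n [[sn ln] <-]] [n' [[sn' ln'] <-]]; congr (pickle (pat _ x)).
  by have [/ln'|/ln|] := ltngtP n n'.
have mpat (X : Type) (M : set_system X) (g : X -> V) n s : measurable_map M B g ->
    M (fun x => pat n (g x) = s).
  by move=> mg; apply: mg (pattern_measurable n s saB BU).
have msep n : B (sep n).
  rewrite /sep; refine (sigma_all_near saB _ (@measurable_map_id V B) _) => h mh.
  apply: (sigma_imp saB).
    rewrite (_ : (fun x => _) = fun x => exists s, pat n x = s /\ pat n (h x) = s).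
      apply: (sigma_ex saB) => s; apply: (sigma_and saB); last exact: mpat.
      exact: mpat (@measurable_map_id V B).
    by apply/funext => x; apply/propext; split=> [->|[s [-> ->]]//]; eexists.
  exact: sigma_eq (@measurable_map_id V B) mh.
exists c; split=> [m|x y xy E].
  rewrite (_ : (fun x => _) = fun x => col x m).
    apply: (sigma_ex saB) => n; apply: (sigma_and saB).
      apply: (sigma_and saB) => //; apply: (sigma_all saB) => j; apply: (sigma_imp saB).
        exact: sigma_const.
      exact: sigma_not.
    rewrite (_ : (fun x => _) = fun x => exists s, pat n x = s /\ pickle s = m).
      apply: (sigma_ex saB) => s; apply: (sigma_and saB); last exact: sigma_const.
      exact: mpat (@measurable_map_id V B).
    by apply/funext => x; apply/propext; split=> [<-|[s [-> ]]//]; eexists.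
  by apply/funext => x; apply/propext; split=> [<-|/(col_uniq _ _ _ (hc x))].
have [n [[sn _] En]] := hc x; have [n' [_ En']] := hc y.
have Ep : pat n x = pat n' y.
  by apply: (pcan_inj pickleK); rewrite En E -En'.
have nn' : n = n' by rewrite -(size_pattern U n x) -[RHS](size_pattern U n' y) -/pat Ep.
by apply: sn => //; rewrite Ep nn'.
Qed.

(** Greedy choice by colour: stage [m] adds at once all points of [D] of colour [m] with no accepted
    point within [s]. Distinct points of one colour are never [s]-near, so they do not conflict. *)
Lemma borel_maximal_discrete (D : set V) s : B D -> exists A, [/\ B A, A `<=` D,
  forall x y, A x -> A y -> near s x y -> x = y &
  forall x, D x -> exists a, A a /\ near s x a].
Proof.
move=> BD; have [c [mc hc]] := borel_coloring s.
pose acc := fix acc n : set V := if n is m.+1 then fun x => acc m x \/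
  (D x /\ c x = m /\ forall y, near s x y -> ~ acc m y) else fun _ => False.
have macc n : B (acc n).
  elim: n => [|n IH] /=; first exact: sigma_const.
  apply: (sigma_or saB) => //; apply: (sigma_and saB) => //; apply: (sigma_and saB) => //.
  refine (sigma_all_near saB _ (@measurable_map_id V B) _) => h mh.
  by apply: (sigma_not saB); exact: mh.
have acc_le m n x : (m <= n)%N -> acc m x -> acc n x.
  move=> /subnKC <-; elim: (n - m)%N => [|k IH]; first by rewrite addn0.
  by rewrite addnS => /IH; left.
have acc_color n x : acc n x -> (c x < n)%N /\ acc (c x).+1 x.
  elim: n => [//|n IH] /= [/IH[xn ?]|[Dx [cx h]]]; first by split=> //; exact: ltnW.
  by rewrite cx; split => //; right.
exists (fun x => exists n, acc n x); split.
- exact: sigma_ex.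
- by move=> x [n]; elim: n => [//|n IH] /= [|[]].
- suff main x y : (c x <= c y)%N -> (exists n, acc n x) -> (exists n, acc n y) ->
      near s x y -> x = y.
    move=> x y Ax Ay xy; have [cxy|/ltnW cyx] := leqP (c x) (c y); first exact: main.
    by apply/esym/main => //; exact: near_sym.
  move=> cxy [n /acc_color[_ Ax]] [m /acc_color[_ Ay]] xy.
  move: cxy; rewrite leq_eqVlt => /predU1P[|cxy]; first exact: hc.
  case: Ay => [/acc_color[]|[_ [_ h]]]; first by rewrite ltnn.
  by case: (h x); [exact: near_sym|exact: acc_le Ax].
- move=> x Dx; have [[y [xy Ay]]|h] := pselect (exists y, near s x y /\ acc (c x) y).
    by exists y; split=> //; exists (c x).
  exists x; split => //; exists (c x).+1; right; split=> //; split=> // y xy Ay.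
  by apply: h; exists y.
Qed.

(** The balls [B(a, s)] are disjoint and lie in [B(x, 6 s)], which lies in [B(a, 11 s)]; by doubling
    each of them has at least [1/D] of its points. *)
Lemma packing s D x (la : seq V) : (0 < s)%N -> uniq la ->
  (forall a, a \in la -> near (5 * s) x a) ->
  (forall a b, a \in la -> b \in la -> near (2 * s) a b -> a = b) ->
  (forall a, a \in la -> (size (enum (16 * s) a) <= D * size (enum s a))%N) ->
  (size la <= D)%N.
Proof.
move=> s0 ula xla disc dbl.
have disj : (\sum_(a <- la) size (enum s a) <= size (enum (6 * s) x))%N.
  have -> : (\sum_(a <- la) size (enum s a) = size (flatten [seq enum s a | a <- la]))%N.
    by rewrite size_flatten /shape -map_comp sumnE big_map.
  apply: uniq_leq_size => [|y /flatten_mapP[a ala /mem_enum ay]]; last first.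
    apply/mem_enum; rewrite (_ : 6 * s = 5 * s + s)%N; last lia.
    exact: near_trans (xla _ ala) ay.
  elim: la ula xla disc {dbl} => [//|a la IH] /= /andP[ala ula] xla disc.
  rewrite cat_uniq enum_uniq IH ?andbT //=; last 2 first.
  - by move=> b bla; apply: xla; rewrite inE bla orbT.
  - by move=> b b' bla b'la; apply: disc; rewrite inE ?bla ?b'la orbT.
  apply/hasPn => y /flatten_mapP[b bla /mem_enum by_]; apply/negP => /mem_enum ay.
  suff E : a = b by rewrite E bla in ala.
  apply: disc; rewrite ?mem_head // ?inE ?bla ?orbT //.
  by rewrite mul2n -addnn; apply: near_trans ay (near_sym by_).
have x0 : (0 < size (enum (6 * s) x))%N.
  have /mem_enum := near_refl (6 * s) x; by case: (enum _ _).
rewrite -(leq_pmul2r x0).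
apply: (@leq_trans (\sum_(a <- la) D * size (enum s a))%N); last first.
  by rewrite -big_distrr /= leq_mul2l disj orbT.
rewrite -sum1_size big_distrl /= !big_seq; apply: leq_sum => a ala.
rewrite mul1n; apply: leq_trans (dbl _ ala); apply: uniq_leq_size => // y /mem_enum xy.
apply/mem_enum; apply: (@near_le (5 * s + 6 * s)); first lia.
exact: near_trans (near_sym (xla _ ala)) xy.
Qed.

(* All [E]-classes close to a maximal [2 * s]-discrete subset [A] of [S] are merged
   according to their centre in [A].  The points of [A] in a ball of radius
   [5 * s] are boundedly many by [packing], hence so are the resulting classes
   near a point of [S]. *)
Lemma coarsening_step D s (S : set V) (E : V -> V -> Prop) : (0 < s)%N -> B S ->
  borel_equivalence B E -> (forall x y, E x y -> near s x y) ->
  (forall a, S a -> (size (enum (16 * s) a) <= D * size (enum s a))%N) ->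
  exists E' : V -> V -> Prop, [/\ borel_equivalence B E',
    forall x y, E x y -> E' x y, forall x y, E' x y -> near (16 * s) x y &
    forall x (l : seq V), S x -> uniq l -> (forall z, z \in l -> near s x z) ->
      (forall z z', z \in l -> z' \in l -> E' z z' -> z = z') -> (size l <= D)%N].
Proof.
move=> s0 BS [[Erefl Esym Etrans] BE] Enear dbl.
have [c [mc hc]] := borel_coloring (16 * s).
have [A [BA AS Adisc Amax]] := borel_maximal_discrete (2 * s) BS.
(* The radius is [s + 2 * s]: from a point within [s] of some [x] in [S] to an element of [A] within
   [2 * s] of [x]. The condition depends only on the [E]-class. *)
pose cand x a := A a /\ exists y, E x y /\ near (3 * s) y a.
(* Candidates of one point are within [8 * s] of each other, so the bounded quantifier, needed for
   measurability, still compares all of them; the radius of the colouring makes the minimum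
   unique. *)
pose centre x a := cand x a /\ forall a', near (8 * s) a a' -> cand x a' -> (c a <= c a')%N.
have cand_near x a : cand x a -> near (4 * s) x a.
  move=> [_ [y [/Enear xy ya]]]; rewrite (_ : 4 * s = s + 3 * s)%N; last lia.
  exact: near_trans xy ya.
have cand_E x x' a : E x x' -> cand x a -> cand x' a.
  by move=> xx' [Aa [y [xy ya]]]; split=> //; exists y; split=> //; apply: Etrans xy; exact: Esym.
have centre_E x x' a : E x x' -> centre x a -> centre x' a.
  move=> xx' [xa ha]; split; first exact: cand_E xa.
  by move=> a' aa' x'a'; apply: ha => //; apply: cand_E x'a'; exact: Esym.
have near_centres x a a' : near (4 * s) x a -> near (4 * s) x a' -> near (8 * s) a a'.
  move=> xa xa'; rewrite (_ : 8 * s = 4 * s + 4 * s)%N; last lia.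
  exact: near_trans (near_sym xa) xa'.
have centre_uniq x a a' : centre x a -> centre x a' -> a = a'.
  move=> [xa ha] [xa' ha']; have aa' := near_centres _ _ _ (cand_near _ _ xa) (cand_near _ _ xa').
  apply: hc; first by apply: near_le aa'; lia.
  by apply/eqP; rewrite eqn_leq ha // ha' //; exact: near_sym.
have centre_ex x a : cand x a -> exists a', centre x a'.
  move=> xa; have [|n [[a' [xa' <-]] hn]] := @nat_least (fun n => exists a, cand x a /\ c a = n).
    by exists (c a), a.
  exists a'; split=> // b _ xb; rewrite leqNgt; apply/negP => /hn; apply.
  by exists b.
have sigma_cand (X : Type) (M : set_system X) (g h : X -> V) : sigma_algebra setT M ->
    measurable_map M B g -> measurable_map M B h -> M (fun x => cand (g x) (h x)).
  move=> saM mg mh; apply: (sigma_and saM); first exact: mh BA.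
  rewrite (_ : (fun x => _) = fun x => exists y, near s (g x) y /\
      (E (g x) y /\ near (3 * s) y (h x))).
    apply: (sigma_ex_near saM _ mg) => k mk; apply: (sigma_and saM).
      exact: borel_relation_sub saM mg mk BE.
    exact: sigma_near.
  apply/funext => x; apply/propext.
  by split=> [[y [xy ya]]|[y [_ [xy ya]]]]; exists y; do ?split => //; exact: Enear.
have sigma_centre (X : Type) (M : set_system X) (g h : X -> V) : sigma_algebra setT M ->
    measurable_map M B g -> measurable_map M B h -> M (fun x => centre (g x) (h x)).
  move=> saM mg mh; apply: (sigma_and saM); first exact: sigma_cand.
  apply: (sigma_all_near saM _ mh) => k mk; apply: (sigma_imp saM); first exact: sigma_cand.
  rewrite (_ : (fun x => _) = fun x => exists m n, (m <= n)%N /\ (c (h x) = m /\ c (k x) = n)).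
    apply: (sigma_ex saM) => m; apply: (sigma_ex saM) => n.
    apply: (sigma_and saM); first exact: sigma_const.
    by apply: (sigma_and saM); [exact: mh (mc m)|exact: mk (mc n)].
  apply/funext => x; apply/propext; split=> [?|[m [n [mn [-> ->]]]]//].
  by exists (c (h x)), (c (k x)).
exists (fun x y => E x y \/ exists a, centre x a /\ centre y a); split.
- split; first split.
  + by move=> x; left.
  + by move=> x y [/Esym|[a [? ?]]]; [left|right; exists a].
  + move=> x y z [xy|[a [xa ya]]] [yz|[b [yb zb]]].
    * by left; exact: Etrans yz.
    * by right; exists b; split=> //; apply: centre_E yb; exact: Esym.
    * by right; exists a; split=> //; exact: centre_E ya.
    * by right; exists a; split=> //; rewrite (centre_uniq _ _ _ ya yb).
  have m1 := measurable_map_fst saB; have m2 := measurable_map_snd saB.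
  apply: (sigma_or sa_prod); first exact: BE.
  rewrite (_ : (fun x => _) = fun p => exists a, near (4 * s) p.1 a /\
      (centre p.1 a /\ centre p.2 a)).
    apply: (sigma_ex_near sa_prod _ m1) => k mk.
    by apply: (sigma_and sa_prod); exact: sigma_centre.
  apply/funext => p; apply/propext; split=> [[a [pa ?]]|[a [_ ?]]]; exists a => //.
  by split => //; apply: cand_near; case: pa.
- by move=> x y; left.
- move=> x y [/Enear|[a [[/cand_near xa _] [/cand_near ya _]]]].
    by apply: near_le; lia.
  apply: (@near_le (4 * s + 4 * s)); first lia.
  exact: near_trans xa (near_sym ya).
move=> x l Sx ul xl hl.
(* This [a0] is a candidate of every [z] within [s] of [x], so each such [z] has a centre;
   inequivalent ones have distinct centres. *)
have [a0 [Aa0 xa0]] := Amax _ Sx.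
have /choice[f hf] : forall z, exists a, z \in l -> centre z a.
  move=> z; have [zl|_] := boolP (z \in l); last by exists z.
  have [|a za] := centre_ex z a0; last by exists a.
  split=> //; exists z; split=> //; apply: (@near_le (s + 2 * s)); first lia.
  exact: near_trans (near_sym (xl _ zl)) xa0.
rewrite -(size_map f); apply: (@packing s D x) => //.
- rewrite map_inj_in_uniq // => z z' zl z'l E0.
  by apply: hl => //; right; exists (f z); split; [exact: hf|rewrite E0; exact: hf].
- move=> _ /mapP[z zl ->]; have [/cand_near za _] := hf _ zl.
  apply: (@near_le (s + 4 * s)); first lia.
  exact: near_trans (xl _ zl) za.
- move=> _ _ /mapP[z /hf[[za _] _] ->] /mapP[z' /hf[[z'a _] _] ->]; exact: Adisc.
- by move=> _ /mapP[z /hf[[/AS/dbl za _] _] ->].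
Qed.

(** A ball has at least [m] points iff [m] words of length at most [r] have distinct endpoints. *)
Lemma borel_ball_size r n : B (fun x => size (enum r x) = n).
Proof.
have ge_size m : B (fun x => (m <= size (enum r x))%N).
  rewrite (_ : (fun x => _) = fun x => exists ws : seq (seq nat),
      (size ws = m /\ all (fun w => size w <= r)%N ws) /\
      forall i j : nat, ((i < m) && (j < m))%N ->
        F (nth [::] ws i) x = F (nth [::] ws j) x -> i = j).
    apply: (sigma_ex saB) => ws; apply: (sigma_and saB); first exact: sigma_const.
    apply: (sigma_all saB) => i; apply: (sigma_all saB) => j.
    apply: (sigma_imp saB); first exact: sigma_const.
    by apply: (sigma_imp saB); [exact: sigma_eq|exact: sigma_const].
  apply/funext => x; apply/propext; split=> [mr|[ws [[sws /allP wsr] inj]]].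
    have /choice[f hf] : forall y, exists w, y \in enum r x -> (size w <= r)%N /\ F w x = y.
      move=> y; have [/mem_enum/nearE[w ?]|_] := boolP (y \in enum r x); last by exists [::].
      by exists w.
    exists (map f (take m (enum r x))); rewrite size_map size_takel //; split.
      by split=> //; apply/allP => _ /mapP[y /mem_take/hf[? _] ->].
    move=> i j /andP[im jm]; have st : size (take m (enum r x)) = m by rewrite size_takel.
    rewrite !(nth_map x) ?st //.
    have mt k : (k < m)%N -> nth x (take m (enum r x)) k \in enum r x.
      by move=> km; apply: mem_take (mem_nth _ _); rewrite st.
    rewrite (hf _ (mt _ im)).2 (hf _ (mt _ jm)).2 => /eqP.
    by rewrite nth_uniq ?st // ?take_uniq // => /eqP.
  rewrite -sws -(size_map (F^~ x)); apply: uniq_leq_size.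
    apply/(uniqP x) => i j; rewrite !inE size_map sws => im jm.
    by rewrite !(nth_map [::]) ?sws // => /inj; apply; rewrite im jm.
  by move=> _ /mapP[w /wsr wr ->]; apply/mem_enum/nearE; exists w.
rewrite (_ : (fun x => _) = fun x => (n <= size (enum r x))%N /\ ~ (n.+1 <= size (enum r x))%N).
  by apply: (sigma_and saB) => //; exact: (sigma_not saB).
apply/funext => x; apply/propext; split=> [<-|[h1 /negP]]; first by rewrite ltnn.
by rewrite -leqNgt => h2; apply/eqP; rewrite eqn_leq h1 h2.
Qed.

(** * From doubling to hyperfiniteness *)

Let reachable x y := exists r, near r x y.

Let reachable_trans x y z : reachable x y -> reachable y z -> reachable x z.
Proof. by move=> [r xy] [s yz]; exists (r + s)%N; exact: near_trans xy yz. Qed.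

Let reachable_equivalence : Equivalence reachable.
Proof.
split; first by move=> x; exists 0%N.
  by move=> x y [r xy]; exists r; exact: near_sym.
exact: reachable_trans.
Qed.

Let reachable_borel : borel_relation B reachable.
Proof.
apply: (sigma_ex sa_prod) => r.
exact: (sigma_near sa_prod r (measurable_map_fst saB) (measurable_map_snd saB)).
Qed.

(* Two points are identified at stage [n] when the finitely many [E n]-classes
   meeting chosen balls around them coincide; the ball around a point is large
   enough to meet every class of the union in its component. *)
Lemma finite_index_hyperfinite D (E : nat -> V -> V -> Prop) (rad : nat -> nat) :
  (forall n, borel_equivalence B (E n)) ->
  (forall n x y, E n x y -> near (rad n) x y) ->
  (forall n x y, E n x y -> E n.+1 x y) ->
  (forall x (l : seq V), uniq l -> (forall z, z \in l -> reachable x z) ->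
    (forall n z z', z \in l -> z' \in l -> E n z z' -> z = z') -> (size l <= D)%N) ->
  hyperfinite B reachable.
Proof.
move=> eqE nearEn E_succ idx.
have E_le m n x y : (m <= n)%N -> E m x y -> E n x y.
  move=> /subnKC <-; elim: (n - m)%N => [|k IH]; first by rewrite addn0.
  by rewrite addnS => /IH; exact: E_succ.
have Erefl n x : E n x x by case: (eqE n) => -[h _ _] _; exact: h.
have Esym n x y : E n x y -> E n y x by case: (eqE n) => -[_ h _] _; exact: h.
have Etrans n x y z : E n x y -> E n y z -> E n x z.
  by case: (eqE n) => -[_ _ h] _; exact: h.
pose full k x := forall y, reachable x y -> exists z, near k x z /\ exists n, E n y z.
have full_ex x : exists k, full k x.
  (* A largest family of pairwise inequivalent points exists by the bound [D]; a ball containing it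
     meets every class of the union. *)
  pose indep m := exists l : seq V, [/\ uniq l, size l = m, (forall z, z \in l -> reachable x z) &
    forall n z z', z \in l -> z' \in l -> E n z z' -> z = z'].
  have ex : exists m, `[< indep m >] by exists 0%N; apply/asboolP; exists [::].
  have ub m : `[< indep m >] -> (m <= D)%N.
    by move=> /asboolP[l [ul <- xl hl]]; exact: (idx x).
  case: (ex_maxnP ex ub) => m /asboolP[l [ul sl xl hl]] maxm.
  have [m' n' z mn'|z zl|k hk] := @eventually_on_seq V l (fun k z => near k x z).
  - exact: near_le.
  - exact: xl.
  exists k => y xy; apply: contrapT => noz.
  suff : (m.+1 <= m)%N by rewrite ltnn.
  have notE n z : z \in l -> ~ E n y z.
    by move=> zl yz; apply: noz; exists z; split; [exact: hk|exists n].
  apply: maxm; apply/asboolP; exists (y :: l); split.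
  - by rewrite /= ul andbT; apply/negP => yl; exact: (notE 0%N y).
  - by rewrite /= sl.
  - by move=> z; rewrite inE => /predU1P[->//|/xl].
  - move=> n z z'; rewrite !inE => /predU1P[->|zl] /predU1P[->|z'l] // h.
    + by case: (notE n z').
    + by case: (notE n z) => //; exact: Esym.
    + exact: hl h.
have /choice[k hk] : forall x, exists k, full k x /\ forall j, (j < k)%N -> ~ full j x.
  by move=> x; apply: nat_least.
have mfull j : B (full j).
  rewrite (_ : full j = fun x => forall r y, near r x y ->
      exists z, near j x z /\ exists n, E n y z).
    apply: (sigma_all saB) => r; refine (sigma_all_near saB _ (@measurable_map_id V B) _) => h mh.
    refine (sigma_ex_near saB _ (@measurable_map_id V B) _) => h' mh'; apply: (sigma_ex saB) => n.
    by apply: borel_relation_sub mh mh' _ => //; case: (eqE n).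
  by apply/funext => x; apply/propext; split=> [h r y xy|h y [r]]; [apply: h; exists r|exact: h].
have mk j : B (fun x => k x = j).
  rewrite (_ : (fun x => _) = fun x => full j x /\ forall i : nat, (i < j)%N -> ~ full i x).
    apply: (sigma_and saB) => //; apply: (sigma_all saB) => i; apply: (sigma_imp saB).
      exact: sigma_const.
    exact: sigma_not.
  apply/funext => x; apply/propext; split=> [<-//|[fj hj]]; have [fk hkx] := hk x.
  by have [/hj|/hkx|] := ltngtP (k x) j.
(* Every [E n]-class meeting the chosen ball of [x] meets that of [y]; symmetrised, this is the
   relation of stage [n]. *)
pose sub n x y := forall z, near (k x) x z -> exists z', near (k y) y z' /\ E n z z'.
have sub_trans n x y z : sub n x y -> sub n y z -> sub n x z.
  move=> xy yz u /xy[v [/yz[w [zw vw]] uv]]; exists w; split=> //; exact: Etrans vw.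
have sub_reachable n x y : sub n x y -> reachable x y.
  move=> /(_ x (near_refl _ _))[z [yz /nearEn xz]].
  exists (rad n + k y)%N; apply: near_trans xz _; exact: near_sym.
have sigma_sub (X : Type) (M : set_system X) (g h : X -> V) n : sigma_algebra setT M ->
    measurable_map M B g -> measurable_map M B h -> M (fun x => sub n (g x) (h x)).
  move=> saM mg mh.
  rewrite (_ : (fun x => _) = fun x => exists i j, (k (g x) = i /\ k (h x) = j) /\
      forall z, near i (g x) z -> exists z', near j (h x) z' /\ E n z z').
    apply: (sigma_ex saM) => i; apply: (sigma_ex saM) => j.
    apply: (sigma_and saM).
      by apply: (sigma_and saM); [exact: mg (mk i)|exact: mh (mk j)].
    refine (sigma_all_near saM _ mg _) => g' mg'; refine (sigma_ex_near saM _ mh _) => h' mh'.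
    by apply: borel_relation_sub mg' mh' _ => //; case: (eqE n).
  apply/funext => x; apply/propext; split=> [h'|[i [j [[<- <-]]]]//].
  by exists (k (g x)), (k (h x)).
split; first exact: (conj reachable_equivalence reachable_borel).
exists (fun n x y => sub n x y /\ sub n y x); split.
- move=> n; split; first split; first split.
  + by move=> x; split=> z xz; exists z; split=> //; exact: Erefl.
  + by move=> x y [].
  + by move=> x y z [xy yx] [yz zy]; split; [exact: sub_trans yz|exact: sub_trans yx].
  + have m1 := measurable_map_fst saB; have m2 := measurable_map_snd saB.
    by apply: (sigma_and sa_prod); exact: sigma_sub.
  (* A point [y] of the class lies in its own ball, hence is [E n]-related to a point of the ball of
     [x]. *)
  move=> x; apply: (@sub_finite_set _ _ [set` enum (k x + rad n) x]); last exact: finite_seq.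
  move=> y [_ /(_ y (near_refl _ _))[z [xz /nearEn yz]]] /=.
  apply/mem_enum; apply: near_trans xz _; exact: near_sym.
- move=> n x y [xy yx].
  by split=> z; [move=> /xy[z' [? ?]]|move=> /yx[z' [? ?]]]; exists z'; split=> //; exact: E_succ.
move=> x y; split=> [xy|[n [/sub_reachable]]//].
(* Each point of the finite ball of [u] is related at some stage to one in the ball of [v]; by
   monotonicity one stage serves all. *)
have sub_ex u v : reachable u v -> exists n, sub n u v.
  move=> uv; pose P n z := exists z', near (k v) v z' /\ E n z z'.
  have [m n z mn|z /mem_enum uz|n hn] := @eventually_on_seq V (enum (k u) u) P.
  - by move=> [z' [? ?]]; exists z'; split=> //; exact: E_le mn _.
  - have [|z' [vz' [n En]]] := (hk v).1 z; last by exists n, z'.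
    apply: reachable_trans (_ : reachable v u) _; last by exists (k u).
    by case: reachable_equivalence => _ h _; exact: h.
  by exists n => z /mem_enum/hn.
have [m hm] := sub_ex _ _ xy; have [|n hn] := sub_ex y x.
  by case: reachable_equivalence => _ h _; exact: h.
exists (maxn m n); split=> z.
  move=> /hm[z' [yz' zz']]; exists z'; split=> //; exact: E_le (leq_maxl _ _) zz'.
move=> /hn[z' [yz' zz']]; exists z'; split=> //; exact: E_le (leq_maxr _ _) zz'.
Qed.

(** One coarsening per scale turns classes bounded by [16 ^ k] into classes bounded by [16 ^ k.+1].
    A doubling scale of [x] beyond the distances to given inequivalent points bounds their
    number. *)
Theorem doubling_hyperfinite D :
  (forall x m, exists k, (m <= k)%N /\
    (size (enum (16 ^ k.+1) x) <= D * size (enum (16 ^ k) x))%N) ->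
  hyperfinite B reachable.
Proof.
move=> dbl.
pose S k x := (size (enum (16 * 16 ^ k) x) <= D * size (enum (16 ^ k) x))%N.
have BS k : B (S k).
  rewrite (_ : (S k : set V) = fun x => exists m n, (m <= D * n)%N /\
      (size (enum (16 * 16 ^ k) x) = m /\ size (enum (16 ^ k) x) = n)).
    apply: (sigma_ex saB) => m; apply: (sigma_ex saB) => n; apply: (sigma_and saB).
      exact: sigma_const.
    by apply: (sigma_and saB); exact: borel_ball_size.
  apply/funext => x; apply/propext; split=> [?|[m [n [mn [Em En]]]]]; last by rewrite /S Em En.
  by exists (size (enum (16 * 16 ^ k) x)), (size (enum (16 ^ k) x)).
pose good k (E : V -> V -> Prop) := borel_equivalence B E /\ forall x y, E x y -> near (16 ^ k) x y.
pose step k (E E' : V -> V -> Prop) := (forall x y, E x y -> E' x y) /\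
  forall x (l : seq V), S k x -> uniq l -> (forall z, z \in l -> near (16 ^ k) x z) ->
      (forall z z', z \in l -> z' \in l -> E' z z' -> z = z') -> (size l <= D)%N.
have /choice[f hf] : forall kE : nat * (V -> V -> Prop), exists E',
    good kE.1 kE.2 -> good kE.1.+1 E' /\ step kE.1 kE.2 E'.
  move=> [k E]; have [[bE nE]|?] := pselect (good k E); last by exists E.
  have [|E' [bE' EE' nE' hE']] := @coarsening_step D (16 ^ k) (S k) E _ (BS k) bE nE (fun _ => id).
    by rewrite expn_gt0.
  by exists E' => _; rewrite /good expnS.
pose E := fix E n := if n is m.+1 then f (m, E m) else fun x y : V => x = y.
have goodE n : good n (E n).
  elim: n => [|n IH]; last by case: (hf (n, E n)).
  split; last by move=> x _ <-.
  split; first by split=> // x y z -> ->.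
  exact: (sigma_eq sa_prod (measurable_map_fst saB) (measurable_map_snd saB)).
have stepE n : step n (E n) (E n.+1) by case: (hf (n, E n)).
apply: (@finite_index_hyperfinite D E (fun n => 16 ^ n)%N).
- by move=> n; case: (goodE n).
- by move=> n; case: (goodE n).
- by move=> n; case: (stepE n).
move=> x l ul xl hl.
have [m n z mn|z zl|m hm] := @eventually_on_seq V l (fun k z => near k x z).
- exact: near_le.
- exact: xl.
have [k [mk Sk]] := dbl x m; have [_ h] := stepE k.
apply: (h x) => //; last by move=> z z' zl z'l; exact: hl.
  by rewrite /S -expnS.
(* The scale [16 ^ k] exceeds [k], hence the radius [m] that contains [l]. *)
move=> z /hm; apply: near_le; apply: leq_trans mk _; exact/ltnW/ltn_expl.
Qed.

End BorelBalls.

(** * Graphs of polynomial growth *)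

Section Walks.
Variables (V : choiceType) (G : V -> V -> Prop).

Lemma walk0 u v : walk G u v 0 <-> u = v.
Proof.
split=> [[p [_ <- /size0nil->]]//|<-]; by exists [::].
Qed.

Lemma walkS u v n : walk G u v n.+1 <-> exists w, G u w /\ walk G w v n.
Proof.
split=> [[[|w p] [//= /andP[/asboolP uw pp] lp [sp]]]|[w [uw [p [pp lp sp]]]]].
  by exists w; split=> //; exists p.
by exists (w :: p); split; rewrite //= ?sp // pp andbT; exact/asboolP.
Qed.

Lemma walk_cat u v w m n : walk G u v m -> walk G v w n -> walk G u w (m + n).
Proof.
elim: m u => [|m IH] u; first by move=> /walk0->.
by move=> /walkS[x [ux /IH h]] /h ?; apply/walkS; exists x.
Qed.

Hypothesis G_sym : Symmetric G.

Lemma walk_sym u v n : walk G u v n -> walk G v u n.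
Proof.
elim: n u => [|n IH] u; first by move=> /walk0->; exact/walk0.
move=> /walkS[x [ux /IH h]]; rewrite -addn1; apply: walk_cat h _.
by apply/walkS; exists u; split; [exact: G_sym|exact/walk0].
Qed.

Definition near_by r u v := exists n, (n <= r)%N /\ walk G u v n.

Lemma near_by_refl r u : near_by r u u.
Proof. by exists 0%N; split=> //; exact/walk0. Qed.

Lemma near_by_sym r u v : near_by r u v -> near_by r v u.
Proof. by move=> [n [nr uv]]; exists n; split=> //; exact: walk_sym. Qed.

Lemma near_by_trans r s u v w : near_by r u v -> near_by s v w -> near_by (r + s) u w.
Proof.
move=> [m [mr uv]] [n [ns vw]]; exists (m + n)%N; split; first exact: leq_add.
exact: walk_cat vw.
Qed.

Lemma near_by_le r s u v : (r <= s)%N -> near_by r u v -> near_by s u v.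
Proof. by move=> rs [n [nr uv]]; exists n; split=> //; exact: leq_trans rs. Qed.

(** A letter follows an edge or stays put, so a word of length at most [r] stays in the [r]-ball,
    and every edge is a letter. *)
Lemma near_by_words (F : nat -> V -> V) :
  (forall x, F 0 x = x) -> (forall i x, F i x = x \/ G x (F i x)) ->
  (forall x y, G x y -> exists i, F i x = y) ->
  forall r x y, near_by r x y <->
    exists w : seq nat, (size w <= r)%N /\ foldl (fun z i => F i z) x w = y.
Proof.
move=> F0 FG GF r x y; split=> [[n [nr xy]]|[w [wr <-]]].
  suff [w [sw <-]] : exists w, size w = n /\ foldl (fun z i => F i z) x w = y.
    by exists w; rewrite sw.
  elim: n x xy {nr} => [|n IH] x; first by move=> /walk0->; exists [::].
  by move=> /walkS[z [/GF[i <-] /IH[w [<- <-]]]]; exists (i :: w).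
apply: near_by_le wr _; elim: w x => [|i w IH] x /=; first exact: near_by_refl.
rewrite -add1n; apply: near_by_trans (IH _).
have [->|xi] := FG i x; first exact: near_by_refl.
by exists 1%N; split=> //; apply/walkS; exists (F i x); split=> //; exact/walk0.
Qed.

End Walks.

(** A finite limit superior bounds a tail of the ratios by some natural [d]; clearing the logarithms
    gives the inequality. *)
Lemma polynomial_growth_bound (R : realType) (V : choiceType) (G : V -> V -> Prop) :
  polynomial_growth G R -> exists d r0 : nat, forall r x (l : seq V), (r0 <= r)%N ->
    uniq l -> (forall y, y \in l -> near_by G r x y) -> (size l <= r.+1 ^ d)%N.
Proof.
move=> /ereal_inf_lt[_ [W [r0 _ r0W] <-]] supW.
have [d hd] : exists d : nat, (ereal_sup
    [set lne (growth G R r) / (ln r.+1%:R)%:E | r in W] <= d%:R%:E)%E.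
  case: ereal_sup supW => [s|//|] _; last by exists 0%N; exact: leNye.
  by exists (Num.truncn s).+1; rewrite lee_fin; apply/ltW/truncnS_gt.
(* The successor forces [r >= 1], so that [ln r.+1] is positive. *)
exists d, r0.+1 => r x l r0r ul xl.
have [->//|l0] := eqVneq l [::].
have size_growth : ((size l)%:R%:E <= growth G R r)%E.
  apply: (@le_trans _ _ (counting (gball G R x r))); last first.
    by apply: ereal_sup_ubound; exists x.
  rewrite /counting; case: ifPn => [/asboolP fin|_]; last exact: leey.
  rewrite lee_fin ler_nat; apply: uniq_leq_size => // y /xl[n [nr xy]].
  have : y \in gball G R x r.
    rewrite inE; apply: (@le_trans _ _ n%:R%:E); last by rewrite lee_fin ler_nat.
    by apply: ereal_inf_lbound; exists n.
  by rewrite -(in_fset_set fin).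
have sl0 : (0 < size l)%N by rewrite lt0n size_eq0.
have lnr : 0 < ln (r.+1%:R : R) by rewrite ln_gt0 // ltr1n; lia.
have hr : (lne (growth G R r) / (ln r.+1%:R)%:E <=
    ereal_sup [set lne (growth G R r) / (ln r.+1%:R)%:E | r in W])%E.
  by apply: ereal_sup_ubound; exists r => //; apply: r0W => /=; lia.
move: {hr} (le_trans hr hd); rewrite inver gt_eqF // lee_pdivrMr // => hr.
have : (lne (size l)%:R%:E <= (d%:R * ln r.+1%:R : R)%:E)%E.
  apply: le_trans hr; rewrite lee_lne // in_itv /= leey andbT.
    by rewrite lee_fin.
  by apply: le_trans size_growth; rewrite lee_fin.
rewrite lne_EFin ?ltr0n // lee_fin mulr_natl -lnXn ?ltr0n //.
by rewrite ler_ln ?posrE ?ltr0n ?exprn_gt0 ?ltr0n // -natrX ler_nat.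
Qed.

Lemma enumerate_bounded (V : eqType) (P : V -> Prop) N :
  (forall l : seq V, uniq l -> (forall y, y \in l -> P y) -> (size l <= N)%N) ->
  exists l : seq V, uniq l /\ forall y, y \in l <-> P y.
Proof.
move=> hN; pose good m := exists l : seq V, [/\ uniq l, size l = m & forall y, y \in l -> P y].
have ex : exists m, `[< good m >] by exists 0%N; apply/asboolP; exists [::].
have ub m : `[< good m >] -> (m <= N)%N by move=> /asboolP[l [ul <- hl]]; exact: hN.
case: (ex_maxnP ex ub) => m /asboolP[l [ul sl hl]] maxm.
exists l; split=> // y; split=> [/hl//|Py]; apply: contrapT => /negP yl.
suff : (m.+1 <= m)%N by rewrite ltnn.
apply: maxm; apply/asboolP; exists (y :: l); split; rewrite /= ?yl ?sl //.
by move=> z; rewrite inE => /predU1P[->|/hl].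
Qed.

(** Without doubling beyond [m], [N (16^(m+j))] is at least [2^j * 16^(dj)], while the polynomial
    bound is at most [2^(d+4dm) * 16^(dj)]. *)
Lemma polynomial_doubling (N : nat -> nat) d r0 : (forall r, (0 < N r)%N) ->
  (forall r, (r0 <= r)%N -> (N r <= r.+1 ^ d)%N) ->
  forall m, exists k, (m <= k)%N /\ (N (16 ^ k.+1) <= 2 * 16 ^ d * N (16 ^ k))%N.
Proof.
move=> N0 Nd m; apply: contrapT => /forallNP h.
have grow j : ((2 * 16 ^ d) ^ j <= N (16 ^ (m + j)))%N.
  elim: j => [|j IH]; first by rewrite expn0.
  rewrite expnS addnS; apply: leq_trans (leq_mul (leqnn _) IH) _.
  apply: ltnW; rewrite ltnNge; apply/negP => hj; apply: (h (m + j)%N).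
  by split=> //; exact: leq_addr.
(* Large enough for [2^j] to exceed [2^(d+4dm)], and for [16^(m+j)] to exceed [r0]. *)
pose j := (d + 4 * (d * m) + r0).+1.
have jj : (j < 16 ^ (m + j))%N by apply: leq_ltn_trans (leq_addl m j) _; exact: ltn_expl.
have large : (r0 <= 16 ^ (m + j))%N by rewrite /j in jj *; lia.
suff : ((16 ^ (m + j)).+1 ^ d < (2 * 16 ^ d) ^ j)%N.
  by rewrite ltnNge (leq_trans (grow j) (Nd _ large)).
apply: (@leq_ltn_trans ((2 * 16 ^ (m + j)) ^ d)).
  by have [->//|d0] := posnP d; rewrite leq_exp2r //; lia.
rewrite !expnMn -!expnM mulnDl expnD mulnA [(d * j)%N]mulnC ltn_pmul2r ?expn_gt0 //.
rewrite (_ : 16 = 2 ^ 4)%N // -expnM -expnD ltn_exp2l // /j; lia.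
Qed.

(** * Borel maps enumerating the neighbours *)

Lemma dense_enumeration (R : realType) (T : pseudoMetricType R) (x0 : T) : separable T ->
  exists q : nat -> T, forall x (e : R), 0 < e -> exists i, ball (q i) e x.
Proof.
move=> [Q /countable_injP[f f_inj] Qdense].
have /choice[q hq] : forall n, exists x, (exists2 y, Q y & f y = n) -> Q x /\ f x = n.
  move=> n; have [[y Qy fy]|h] := pselect (exists2 y, Q y & f y = n); last by exists x0.
  by exists y.
exists q => x e e0.
have [|y [/interior_subset xy Qy]] := Qdense (interior (ball x e)) _ (open_interior _).
  by exists x; apply: nbhs_singleton; apply: nbhs_interior; exact: nbhsx_ballx.
exists (f y); have [|Qq fq] := hq (f y); first by exists y.
rewrite (_ : q (f y) = y); first exact: ball_sym.
by apply: f_inj; rewrite ?inE.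
Qed.

(** The graph is carried to a Polish space, where [borel_finite_sections] applies, and the resulting
    maps are carried back. *)
Lemma borel_graph_neighbours (R : realType) (V : choiceType) (B : set_system V)
    (G : V -> V -> Prop) k (v0 : V) : standard_borel R B -> borel_relation B G ->
  (forall x (l : seq V), uniq l -> (forall y, y \in l -> G x y) -> (size l <= k)%N) ->
  [/\ sigma_algebra setT B,
    exists U : nat -> set V, (forall j, B (U j)) /\
      forall x y, x != y -> exists j, U j x /\ ~ U j y &
    exists F : nat -> V -> V, [/\ forall i, measurable_map B B (F i),
      forall x, F 0%N x = x, forall i x, F i x = x \/ G x (F i x) &
      forall x y, G x y -> exists i, F i x = y]].
Proof.
move=> [T [f [T_complete T_sep [g fK gK] BE]]] BG Gk.
have [q q_dense] := dense_enumeration (f v0) T_sep.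
pose borel := <<s @open T >>; have sa : sigma_algebra setT borel := sigma_generated _.
have BP A : B A <-> borel (g @^-1` A).
  rewrite BE; split=> [[A' mA' <-]|mA].
    by rewrite -comp_preimage (_ : f \o g = id) ?preimage_id //; apply/funext => x; exact: gK.
  exists (g @^-1` A) => //.
  by rewrite -comp_preimage (_ : g \o f = id) ?preimage_id //; apply/funext => x; exact: fK.
have saB : sigma_algebra setT B.
  split=> [|A|A hA]; first by apply/BP; rewrite preimage_set0; exact: sigma_algebra0.
    by move=> /BP mA; apply/BP; rewrite setTD; exact: (sigma_not sa mA).
  apply/BP; rewrite preimage_bigcup; apply: sigma_algebra_bigcup => n; exact/BP.
have mg : measurable_map borel B g by move=> A /BP.
have mf : measurable_map B borel f by move=> A mA; rewrite BE; exists A.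
have [||I [F [mF GF]]] := @borel_finite_sections R T T_complete q q_dense k
    (fun a b => G (g a) (g b)).
- have sa2 := sigma_generated [set A `*` A' | A in borel & A' in borel].
  apply: (borel_relation_sub sa2 _ _ BG).
    exact: measurable_map_comp (measurable_map_fst sa) mg.
  exact: measurable_map_comp (measurable_map_snd sa) mg.
- move=> x l ul hl; rewrite -(size_map g); apply: (Gk (g x)).
    by rewrite map_inj_uniq //; exact: can_inj gK.
  by move=> _ /mapP[y /hl ? ->].
split=> //.
  have [U [mU sepU]] := countable_separating q_dense.
  exists (fun j => f @^-1` U j); split=> [j|x y xy]; first exact: mf (mU j).
  by apply: sepU; rewrite (inj_eq (can_inj fK)).
pose h i x := g (F i (f x)).
have mh i : measurable_map B B (h i).
  exact: measurable_map_comp (measurable_map_comp mf (mF i)) mg.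
(* Where [h i] does not lead to a neighbour it is replaced by the identity. *)
pose h' i x := if `[< G x (h i x) >] then h i x else x.
have mh' i : measurable_map B B (h' i).
  move=> A BA; rewrite (_ : _ @^-1` _ = fun x => (G x (h i x) /\ A (h i x)) \/
      (~ G x (h i x) /\ A x)).
    have BGi := borel_relation_sub saB (@measurable_map_id V B) (mh i) BG.
    apply: (sigma_or saB); apply: (sigma_and saB) => //; first exact: mh BA.
    exact: (sigma_not saB).
  apply/funext => x; apply/propext; rewrite /preimage /= /h'; case: ifPn => /asboolP Gx.
    by split=> [?|[[]//|[]//]]; left.
  by split=> [?|[[]//|[]//]]; right.
exists (fun n => if n is m.+1 then if unpickle m is Some i then h' i else id else id); split=> //.
- by move=> [|n] //; case: (unpickle n).
- move=> [|n] x; first by left.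
  case: (unpickle n) => [i|]; last by left.
  by rewrite /h'; case: ifPn => [/asboolP|]; [right|left].
- move=> x y Gxy; have [|i Fi] := GF (f x) (f y); first by rewrite !fK.
  exists (pickle i).+1; rewrite pickleK.
  by rewrite /h' /h Fi fK; case: ifPn => // /asboolP.
Qed.

Theorem corollary1p16 (R : realType) (V : choiceType) (B : set_system V)
    (G : V -> V -> Prop) :
  borel_graph R B G -> polynomial_growth G R -> hyperfinite_graph B G.
Proof.
move=> [stdB G_sym _ BG] /polynomial_growth_bound[d [r0 bound]].
have connE : connected_in G = fun x y => exists r, near_by G r x y.
  apply/funext => x; apply/funext => y; apply/propext.
  by split=> [[n xy]|[_ [n [_ xy]]]]; [exists n; exists n|exists n].
(* Enumerating a dense set requires a default point, so the empty space is treated apart. *)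
have [[v0]|empty] := pselect (inhabited V); last first.
  have eqB (E : V -> V -> Prop) : borel_equivalence B E.
    split; first by split=> x; case: empty; exists.
    rewrite /borel_relation (_ : [set p | _] = set0); first exact: sigma_algebra0.
    by apply/seteqP; split=> // -[x]; case: empty; exists.
  split; first exact: eqB.
  exists (fun _ => connected_in G); split=> [n|//|x]; last by case: empty; exists.
  by split; [exact: eqB|move=> x; case: empty; exists].
(* Radii below [r0] are covered by monotonicity; the case [r = 1] bounds the degrees. *)
have near_bound r x (l : seq V) : uniq l -> (forall y, y \in l -> near_by G r x y) ->
    (size l <= (maxn r r0).+1 ^ d)%N.
  move=> ul xl; apply: (bound _ x) => //; first exact: leq_maxr.
  by move=> y /xl; apply: near_by_le; exact: leq_maxl.
have [x l ul xl|saB [U [BU sepU]] [F [mF F0 FG GF]]] :=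
    borel_graph_neighbours (k := (maxn 1 r0).+1 ^ d) v0 stdB BG.
  apply: (near_bound 1%N x) => // y /xl xy; exists 1%N; split=> //.
  by apply/walkS; exists y; split=> //; exact/walk0.
have /choice[enum henum] : forall rx : nat * V, exists l : seq V,
    uniq l /\ forall y, y \in l <-> near_by G rx.1 rx.2 y.
  by move=> [r x]; apply: enumerate_bounded (near_bound r x).
rewrite /hyperfinite_graph connE.
apply: (@doubling_hyperfinite V B saB U BU sepU (near_by G)
  (fun w x => foldl (fun z i => F i z) x w) _ _ _ _ _ _ (fun r x => enum (r, x)) _ _ (2 * 16 ^ d)).
- by elim=> [|i w IH] /=; [exact: measurable_map_id|exact: measurable_map_comp (mF i) IH].
- exact: near_by_words.
- exact: near_by_refl.
- exact: near_by_sym.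
- exact: near_by_trans.
- exact: near_by_le.
- by move=> r x; case: (henum (r, x)).
- by move=> r x; case: (henum (r, x)).
move=> x; apply: (@polynomial_doubling (fun r => size (enum (r, x))) d r0) => r.
  have [_ /(_ x)] := henum (r, x); case: (enum (r, x)) => // -[_ h].
  by have := h (near_by_refl G r x).
move=> r0r; have [ul hl] := henum (r, x); apply: (bound r x) => // y /hl //.
Qed.
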